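(* There exist numbers $\tilde\alpha(k,n)\in(1,n+1)$ (for $k\in\{1,\dots,n\}$) such that the only equilibria (up to permutation of coordinates) of the WARM star graph with $n\ge2$ edges and $W(x)=x^\alpha$, $\alpha>1$, are given by the following, where in (ii)–(iv) $v=v(\alpha)>u=u(\alpha)$: (i) $(1/n)_n$ for $\alpha>1$; (ii) $((v)_k,(u)_{n-k})$ for $1\le k<n/2$ and $\alpha>\tilde\alpha(k,n)$, with $v(\alpha)$ increasing in $\alpha$; (iii) $((v)_k,(u)_{n-k})$ for $1\le k<n/2$ and $\alpha\in(\tilde\alpha(k,n),n+1)$, with $v(\alpha)$ decreasing in $\alpha$; (iv) $((v)_k,(u)_{n-k})$ for $n/2\le k\le n-1$ and $\alpha>n+1$, with $v(\alpha)$ increasing in $\alpha$. Moreover, $(1/n)_n$ is linearly stable if and only if $\alpha<n+1$ (it is critical when $\alpha=n+1$). Equilibrium (ii) is linearly stable if and only if $k=1$ and $\alpha>\tilde\alpha(1,n)$ (in which case $v(+\infty)=2/(n+1)$, i.e. $v(\alpha)\to2/(n+1)$ as $\alpha\to\infty$). All other equilibria are not linearly stable.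
   Context: $(a)_k$ denotes the vector $(a,\dots,a)\in\mathbb R^k$. The star graph with $n$ edges has a central vertex joined to $n$ leaves; in the WARM on it (with $n+1$ vertices), every edge has initial count 1, and at each time a vertex is chosen uniformly at random (independently of the past) and an edge incident to it is selected with probability proportional to $W(\text{current count})$, $W(x)=x^\alpha$, and its count is increased by one. With $\Delta_n=\{\vec u\in\mathbb R^n:u_i\ge0,\ \sum_iu_i=1\}$, let $$F(\vec v)_i=-v_i+\frac1{n+1}+\frac1{n+1}\cdot\frac{v_i^\alpha}{\sum_{j=1}^nv_j^\alpha},\qquad i=1,\dots,n.$$ An equilibrium is a $\vec v\in\Delta_n$ with $F(\vec v)=\vec 0$. $\mathbf D(\vec v)$ is the matrix of partial derivatives $\partial F_i/\partial v_k$ at $\vec v$. The equilibrium is linearly stable if all eigenvalues of $\mathbf D(\vec v)$ have negative real parts, linearly unstable if some eigenvalue has positive real part, and critical otherwise.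
   Formalization: Family (ii) also includes the endpoint α = α̃(k,n), where one such equilibrium exists (not linearly stable); and equilibrium (iv) is claimed linearly stable if and only if n = 2, since for n = 2, k = 1, α > 3 it is in fact stable. *)

(* Defs.v *)
From HB Require Import structures.
From mathcomp Require Import all_boot all_order all_algebra all_fingroup.
From mathcomp Require Import all_classical all_reals all_analysis.
From mathcomp.real_closed Require Import complex.

Set Implicit Arguments.
Unset Strict Implicit.
Unset Printing Implicit Defensive.

Import Order.TTheory GRing.Theory Num.Theory.
Import numFieldNormedType.Exports.

Local Open Scope classical_set_scope.
Local Open Scope ring_scope.

Definition std_simplex (R : realType) (n : nat) : set 'rV[R]_n :=
  [set u | (forall i, 0 <= u 0 i) /\ \sum_i u 0 i = 1].

(* Mean-field vector field of the WARM on the star with n edges (hence n.+1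
   vertices) and W(x) = x^a: with probability 1/(n+1) each, edge i is selected
   from its own leaf (surely) or from the centre (proportionally to W). *)
Definition warm_star_field (R : realType) (n : nat) (a : R) (v : 'rV[R]_n) :
    'rV[R]_n :=
  \row_i (- v 0 i + n.+1%:R^-1
          + n.+1%:R^-1 * ((v 0 i `^ a) / \sum_j (v 0 j `^ a))).

Definition equilibrium (R : realType) (n : nat) (a : R) (v : 'rV[R]_n) : Prop :=
  std_simplex v /\ warm_star_field a v = 0.

(* Entry (i, k) is dF_i/dv_k; [jacobian] is not used because it acts on row
   vectors, i.e. it is the transpose of this matrix. *)
Definition warm_star_D (R : realType) (n : nat) (a : R) (v : 'rV[R]_n) :
    'M[R]_n :=
  \matrix_(i, k)
    derive (fun w : 'rV[R]_n => warm_star_field a w 0 i : R) v (delta_mx 0 k).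

Definition complex_eigenvalue (R : realType) (n : nat) (A : 'M[R]_n) (z : R[i]) :
    Prop :=
  eigenvalue (map_mx (real_complex R) A) z.

Definition linearly_stable (R : realType) (n : nat) (a : R) (v : 'rV[R]_n) :
    Prop :=
  forall z : R[i], complex_eigenvalue (warm_star_D a v) z -> complex.Re z < 0.

Definition linearly_unstable (R : realType) (n : nat) (a : R) (v : 'rV[R]_n) :
    Prop :=
  exists2 z : R[i], complex_eigenvalue (warm_star_D a v) z & 0 < complex.Re z.

Definition critical (R : realType) (n : nat) (a : R) (v : 'rV[R]_n) : Prop :=
  ~ linearly_stable a v /\ ~ linearly_unstable a v.

(* ((v)_k, (u)_{n-k}) *)
Definition two_block (R : realType) (n k : nat) (v u : R) : 'rV[R]_n :=
  \row_(i < n) (if (i < k)%N then v else u).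

Definition equal_up_to_perm (R : realType) (n : nat) (w x : 'rV[R]_n) : Prop :=
  exists s : 'S_n, w = col_perm s x.

(* Main.v *)
(* At an equilibrium the map x -> ln (N x - 1) - a ln x, with N = n + 1, takes the
   same value at all coordinates; its derivative vanishes only once, so by Rolle
   there are at most two coordinate values v > u. If v occurs k times, put p = k,
   q = n - k and t = v / u. The normalisation gives u = 1 / (p t + q), and the
   equilibrium condition becomes ((q + 1) t - q) / (p + 1 - p t) = t^a, that is
   a = A(t) := L(t) / ln t, for 1 < t < (p + 1) / p. The sign of A' is the sign of
   H = ln t * P - L with P = t L', and H' = ln t * P', where P' changes sign at most
   once: A increases from N to infinity if k >= n / 2, and otherwise decreases from
   N to a minimum (the threshold) and then increases to infinity.
   At an equilibrium, D = - I + (a / N) (diag d - r d^T) with d_i = N - 1 / v_i and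
   r_i = v_i d_i. The eigenvalues of diag d - r d^T are 0, d_u (if n - k >= 2),
   d_v (if k >= 2) and d_u d_v = N / P(t), while Rolle gives a d_u < N < a d_v. Hence
   k >= 2 is never stable, and k = 1 is stable iff a < P(t), i.e. iff A'(t) > 0. *)

Require Import Defs.
From HB Require Import structures.
From mathcomp Require Import all_boot all_order all_algebra all_fingroup.
From mathcomp Require Import all_classical all_reals all_analysis.
From mathcomp.real_closed Require Import complex.
From mathcomp Require Import ring lra zify.

Set Implicit Arguments.
Unset Strict Implicit.
Unset Printing Implicit Defensive.

Import Order.TTheory GRing.Theory Num.Theory.
Import numFieldNormedType.Exports.

Local Open Scope classical_set_scope.
Local Open Scope ring_scope.

(** * Mean value and intermediate value arguments from an explicit derivative *)

Lemma is_derive_within_continuous (R : realType) (f df : R -> R) (x y : R) :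
  (forall z, x <= z <= y -> is_derive z 1 f (df z)) ->
  {within `[x, y], continuous f}.
Proof.
move=> dfE; apply: derivable_within_continuous => z.
by rewrite in_itv/= => /dfE [].
Qed.

Lemma mean_value (R : realType) (f df : R -> R) (x y : R) : x < y ->
  (forall z, x <= z <= y -> is_derive z 1 f (df z)) ->
  exists2 c, x < c < y & f y - f x = df c * (y - x).
Proof.
move=> xy dfE; have [||c] := @MVT R f df x y xy.
- by move=> z; rewrite in_itv/= => /andP[/ltW xz /ltW zy]; apply: dfE; rewrite xz.
- exact: is_derive_within_continuous dfE.
- by rewrite in_itv/=; exists c.
Qed.

Lemma derive_pos_lt (R : realType) (f df : R -> R) (x y : R) : x < y ->
  (forall z, x <= z <= y -> is_derive z 1 f (df z)) ->
  (forall z, x < z < y -> 0 < df z) -> f x < f y.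
Proof.
move=> xy dfE df0; have [c xcy e] := mean_value xy dfE.
by rewrite -subr_gt0 e mulr_gt0 ?df0// subr_gt0.
Qed.

Lemma derive_neg_lt (R : realType) (f df : R -> R) (x y : R) : x < y ->
  (forall z, x <= z <= y -> is_derive z 1 f (df z)) ->
  (forall z, x < z < y -> df z < 0) -> f y < f x.
Proof.
move=> xy dfE df0; have [c xcy e] := mean_value xy dfE.
by rewrite -subr_lt0 e nmulr_rlt0 ?df0// subr_gt0.
Qed.

Lemma derivable_IVT (R : realType) (f df : R -> R) (x y l : R) : x <= y ->
  (forall z, x <= z <= y -> is_derive z 1 f (df z)) ->
  Num.min (f x) (f y) <= l <= Num.max (f x) (f y) ->
  exists2 c, x <= c <= y & f c = l.
Proof.
move=> xy dfE fl; have [|c] := @IVT R f x y l xy _ fl.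
  exact: is_derive_within_continuous dfE.
by rewrite in_itv/=; exists c.
Qed.

(** * The one-parameter profile of two-valued equilibria *)

(** With N = p + q + 1 and u = 1 / (p t + q), one has N u - 1 = (p + 1 - p t) u and N t u - 1 = ((q
    + 1) t - q) u. Thus [starL] is the logarithm of (N v - 1) / (N u - 1) for v = t u. *)
Definition starL (R : realType) (p q t : R) : R :=
  ln ((q + 1) * t - q) - ln (p + 1 - p * t).
Definition starP (R : realType) (p q t : R) : R :=
  (q + 1) * t / ((q + 1) * t - q) + p * t / (p + 1 - p * t).
Definition starP' (R : realType) (p q t : R) : R :=
  p * (p + 1) / (p + 1 - p * t) ^+ 2 - q * (q + 1) / ((q + 1) * t - q) ^+ 2.
Definition starH (R : realType) (p q t : R) : R := ln t * starP p q t - starL p q t.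
Definition starA (R : realType) (p q t : R) : R := starL p q t / ln t.

Lemma affine_gt0 (R : realType) (q t : R) : 0 < q -> 1 <= t ->
  0 < (q + 1) * t - q.
Proof. by move=> q0 t1; nra. Qed.

Lemma is_derive_affine (R : realType) (a b t : R) :
  is_derive t 1 (fun t : R => a * t + b) a.
Proof. by apply: is_derive_eq; rewrite /GRing.scale/=; ring. Qed.

Lemma is_derive_ln_comp (R : realType) (f : R -> R) (df t : R) : 0 < f t ->
  is_derive t 1 f df -> is_derive t 1 (fun t => ln (f t)) (df / f t).
Proof.
move=> f0 dfE; have := is_derive1_ln f0 => dln.
by apply: (is_derive_eq (is_derive1_comp dln dfE)); rewrite mulrC.
Qed.

Lemma is_derive_div (R : realType) (f g : R -> R) (df dg t : R) : g t != 0 ->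
  is_derive t 1 f df -> is_derive t 1 g dg ->
  is_derive t 1 (fun t => f t / g t) ((df * g t - f t * dg) / g t ^+ 2).
Proof.
move=> g0 dfE dgE; have dV := is_deriveV g0 dgE.
by apply: is_derive_eq; rewrite /GRing.scale/=; field.
Qed.

Section profile_derivatives.
Variables (R : realType) (p q t : R).
Hypotheses (q0 : 0 < q) (t1 : 1 <= t) (tp : p * t < p + 1).

Let den1 : 0 < (q + 1) * t - q. Proof. exact: affine_gt0. Qed.
Let den2 : 0 < p + 1 - p * t. Proof. by rewrite subr_gt0. Qed.
Let d1 : is_derive t 1 (fun t => (q + 1) * t - q) (q + 1).
Proof. exact: is_derive_affine. Qed.
Let d2 : is_derive t 1 (fun t => p + 1 - p * t) (- p).
Proof. by apply: is_derive_eq; rewrite /GRing.scale/=; ring. Qed.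
Let dM (c : R) : is_derive t 1 (fun t => c * t) c.
Proof. by apply: is_derive_eq; rewrite /GRing.scale/=; ring. Qed.

Lemma is_derive_starL : is_derive t 1 (starL p q) (starP p q t / t).
Proof.
have e1 := is_derive_ln_comp (f := fun t => (q + 1) * t - q) den1 d1.
have e2 := is_derive_ln_comp (f := fun t => p + 1 - p * t) den2 d2.
apply: (is_derive_eq (is_deriveB e1 e2)); rewrite /starP.
by field; rewrite !gt_eqF// (lt_le_trans _ t1).
Qed.

Lemma is_derive_starP : is_derive t 1 (starP p q) (starP' p q t).
Proof.
have e1 := is_derive_div (g := fun t => (q + 1) * t - q) (lt0r_neq0 den1) (dM (q + 1)) d1.
have e2 := is_derive_div (g := fun t => p + 1 - p * t) (lt0r_neq0 den2) (dM p) d2.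
apply: (is_derive_eq (is_deriveD e1 e2)); rewrite /starP'.
by field; rewrite !gt_eqF.
Qed.

(** The product rule yields starP / t + ln t * starP', and its first term cancels against the
    derivative of [starL]. *)
Lemma is_derive_starH : is_derive t 1 (starH p q) (ln t * starP' p q t).
Proof.
have t0 : 0 < t by exact: lt_le_trans t1.
have dL := is_derive_starL; have dP := is_derive_starP.
have dln := is_derive1_ln t0.
apply: (is_derive_eq (is_deriveB (is_deriveM dln dP) dL)).
by rewrite /GRing.scale/=; ring.
Qed.

Lemma is_derive_starA : 1 < t ->
  is_derive t 1 (starA p q) (starH p q t / (t * ln t ^+ 2)).
Proof.
move=> lt1; have t0 : 0 < t by exact: lt_trans lt1.
have ln0 : ln t != 0 by rewrite gt_eqF// ln_gt0.
have dL := is_derive_starL; have dln := is_derive1_ln t0.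
apply: (is_derive_eq (is_derive_div ln0 dL dln)).
by rewrite /starH; field; rewrite ln0 gt_eqF.
Qed.

End profile_derivatives.

Lemma starL1 (R : realType) (p q : R) : starL p q 1 = 0.
Proof. by rewrite /starL !mulr1 addrAC subrr add0r addrAC subrr add0r ln1 subrr. Qed.

Lemma starP1 (R : realType) (p q : R) : starP p q 1 = p + q + 1.
Proof.
by rewrite /starP !mulr1 addrAC subrr add0r addrAC subrr add0r !divr1; ring.
Qed.

Lemma starH1 (R : realType) (p q : R) : starH p q 1 = 0.
Proof. by rewrite /starH starL1 ln1 mul0r subrr. Qed.

Lemma starAE (R : realType) (p q t a : R) : 1 < t ->
  (starA p q t = a) <-> (starL p q t = a * ln t).
Proof.
move=> t1; have ln0 : ln t != 0 by rewrite gt_eqF// ln_gt0.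
by rewrite /starA; split=> [<-|->]; rewrite (mulfK, divfK).
Qed.

(* [sqrt (p (p + 1)) ((q + 1) t - q) - sqrt (q (q + 1)) (p + 1 - p t)] has the
   sign of [starP'] and is affine increasing in [t]. *)
Lemma starP'_sign (R : realType) (p q : R) : 0 < p -> 0 < q ->
  exists2 c : R, p * c < p + 1 &
    [/\ p < q -> 1 < c, q <= p -> c <= 1,
     forall t, 1 <= t -> p * t < p + 1 -> t < c -> starP' p q t < 0 &
     forall t, 1 <= t -> p * t < p + 1 -> c < t -> 0 < starP' p q t].
Proof.
move=> p0 q0; pose r := Num.sqrt (p * (p + 1)); pose s := Num.sqrt (q * (q + 1)).
have r0 : 0 < r by rewrite sqrtr_gt0; nra.
have s0 : 0 < s by rewrite sqrtr_gt0; nra.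
have r2 : r ^+ 2 = p * (p + 1) by rewrite sqr_sqrtr//; nra.
have s2 : s ^+ 2 = q * (q + 1) by rewrite sqr_sqrtr//; nra.
have D0 : 0 < r * (q + 1) + s * p by nra.
(* The zero in t of the affine function r ((q + 1) t - q) - s (p + 1 - p t). *)
pose c := (s * (p + 1) + r * q) / (r * (q + 1) + s * p).
have cE : c * (r * (q + 1) + s * p) = s * (p + 1) + r * q by rewrite divfK ?gt_eqF.
(* Written with r and s, [starP'] is a difference of two squares; the difference factor is a
   positive multiple of t - c and the sum factor is positive. *)
have sgn t : 1 <= t -> p * t < p + 1 ->
    starP' p q t = (t - c) * ((r * (q + 1) + s * p) *
      (r / (p + 1 - p * t) + s / ((q + 1) * t - q)) /
      ((p + 1 - p * t) * ((q + 1) * t - q))).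
  move=> t1 tp; have := affine_gt0 q0 t1; rewrite -subr_gt0 in tp => u0.
  have -> : (t - c) * ((r * (q + 1) + s * p) *
      (r / (p + 1 - p * t) + s / ((q + 1) * t - q)) /
      ((p + 1 - p * t) * ((q + 1) * t - q))) =
    (t * (r * (q + 1) + s * p) - c * (r * (q + 1) + s * p)) *
    ((r / (p + 1 - p * t) + s / ((q + 1) * t - q)) /
      ((p + 1 - p * t) * ((q + 1) * t - q))) by field; rewrite !gt_eqF.
  by rewrite cE /starP' -r2 -s2; field; rewrite !gt_eqF.
have pos t : 1 <= t -> p * t < p + 1 -> 0 < (r * (q + 1) + s * p) *
      (r / (p + 1 - p * t) + s / ((q + 1) * t - q)) /
      ((p + 1 - p * t) * ((q + 1) * t - q)).
  move=> t1 tp; have := affine_gt0 q0 t1; rewrite -subr_gt0 in tp => u0.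
  apply: divr_gt0; last exact: mulr_gt0.
  by apply: mulr_gt0 => //; apply: addr_gt0; apply: divr_gt0.
exists c; first by rewrite /c mulrA ltr_pdivrMr//; nra.
split=> [pq|qp|t t1 tp tc|t t1 tp tc].
- rewrite /c ltr_pdivlMr// mul1r; suff : r < s by nra.
  by rewrite ltr_sqrt; nra.
- rewrite /c ler_pdivrMr// mul1r; suff : s <= r by nra.
  by rewrite ler_sqrt; nra.
- by rewrite sgn// nmulr_rlt0 ?pos// subr_lt0.
- by rewrite sgn// mulr_gt0 ?pos// subr_gt0.
Qed.

(** Where starA t = a, the sign of [starH], hence the slope of the profile, is the sign of starP t -
    a, the quantity that decides stability. *)
Lemma starHE (R : realType) (p q t : R) : 1 < t ->
  starH p q t = ln t * (starP p q t - starA p q t).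
Proof.
move=> t1; have ln0 : ln t != 0 by rewrite gt_eqF// ln_gt0.
by rewrite /starH /starA; field.
Qed.

(** As s tends to (p + 1) / p, the term - ln (p + 1 - p s) tends to infinity while ln s stays
    bounded. *)
Lemma starA_unbounded (R : realType) (p q t a : R) : 0 < p -> 0 < q -> 1 <= t ->
  p * t < p + 1 -> exists s, [/\ t < s, p * s < p + 1 & a < starA p q s].
Proof.
move=> p0 q0 t1 tp; pose b := 1 + p^-1.
have b1 : 1 < b by rewrite ltrDl invr_gt0.
(* [K] bounds a ln s, since s < b. [y] is the value prescribed for p + 1 - p s: below exp(-K) it
   makes the numerator exceed K, and below p + 1 - p t it puts s to the right of t; halving makes
   both strict. *)
pose K := `|a| * ln b; pose y := Num.min (expR (- K)) (p + 1 - p * t) / 2.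
have y0 : 0 < y by rewrite divr_gt0// lt_min expR_gt0 subr_gt0.
have yK : y < expR (- K).
  have : Num.min (expR (- K)) (p + 1 - p * t) <= expR (- K) by rewrite ge_min lexx.
  by rewrite /y; have := expR_gt0 (- K); lra.
have yt : y < p + 1 - p * t.
  have : Num.min (expR (- K)) (p + 1 - p * t) <= p + 1 - p * t.
    by rewrite ge_min lexx orbT.
  by rewrite /y; lra.
pose s := (p + 1 - y) / p; have psE : p * s = p + 1 - y by rewrite /s mulrC divfK ?gt_eqF.
have ts : t < s by rewrite /s ltr_pdivlMr// mulrC; lra.
have s1 : 1 < s by exact: le_lt_trans ts.
exists s; split=> //; first by lra.
rewrite /starA ltr_pdivlMr ?ln_gt0//.
have lns : a * ln s <= K.
  apply: (@le_trans _ _ (`|a| * ln s)).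
    by rewrite ler_wpM2r ?ler_norm// ltW// ln_gt0.
  rewrite ler_wpM2l//; rewrite ler_ln ?posrE ?(lt_trans ltr01)//.
  by rewrite /s ler_pdivrMr// /b mulrDl mul1r mulVf ?gt_eqF//; lra.
apply: (le_lt_trans lns); rewrite /starL psE.
have -> : p + 1 - (p + 1 - y) = y by ring.
have : ln y < - K by rewrite -[X in _ < X]expRK ltr_ln// posrE expR_gt0.
have : 0 <= ln ((q + 1) * s - q) by apply: ln_ge0; nra.
by lra.
Qed.

Section sublevel.
Variables (R : realType) (p q t a : R).
Hypotheses (p0 : 0 < p) (q0 : 0 < q) (t1 : 1 < t) (tp : p * t < p + 1).

Let dG z : 1 <= z <= t ->
  is_derive z 1 (fun z => starL p q z - a * ln z) ((starP p q z - a) / z).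
Proof.
move=> /andP[z1 zt]; have z0 : 0 < z by exact: lt_le_trans z1.
have zp : p * z < p + 1 by apply: le_lt_trans tp; rewrite ler_pM2l.
have dL := is_derive_starL q0 z1 zp; have dln := is_derive1_ln z0.
have dal : is_derive z 1 (fun z => a * ln z) (a / z).
  by apply: is_derive_eq; rewrite /GRing.scale/=; ring.
by apply: (is_derive_eq (is_deriveB dL dal)); field; rewrite gt_eqF.
Qed.

(** The function starL - a ln vanishes at 1 and has derivative (starP - a) / z, so a bound on
    [starP] over (1, t) passes to starA t. This replaces a limit at t = 1, where [starA] has the
    form 0 / 0. *)
Lemma starA_gt : (forall z, 1 < z < t -> a < starP p q z) -> a < starA p q t.
Proof.
move=> aP; rewrite /starA ltr_pdivlMr ?ln_gt0// -subr_gt0.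
have := derive_pos_lt t1 dG; rewrite starL1 ln1 mulr0 subrr; apply=> z z1t.
by rewrite divr_gt0 ?subr_gt0 ?aP//; case/andP: z1t => /(lt_trans ltr01).
Qed.

Lemma starA_lt : (forall z, 1 < z < t -> starP p q z < a) -> starA p q t < a.
Proof.
move=> aP; rewrite /starA ltr_pdivrMr ?ln_gt0// -subr_lt0.
have := derive_neg_lt t1 dG; rewrite starL1 ln1 mulr0 subrr; apply=> z z1t.
by rewrite pmulr_llt0 ?subr_lt0 ?aP// invr_gt0; case/andP: z1t => /(lt_trans ltr01).
Qed.

End sublevel.

(** The quotient ((q + 1) t - q) / (p + 1 - p t) exceeds t, because (q + 1) t - q - t (p + 1 - p t)
    = (t - 1) (p t + q). This keeps the threshold above 1. *)
Lemma starA_gt1 (R : realType) (p q t : R) : 0 < p -> 0 < q -> 1 < t ->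
  p * t < p + 1 -> 1 < starA p q t.
Proof.
move=> p0 q0 t1 tp; have t0 : 0 < t by exact: lt_trans t1.
have D1 := affine_gt0 q0 (ltW t1); rewrite -subr_gt0 in tp.
rewrite /starA ltr_pdivlMr ?ln_gt0// mul1r /starL -ln_div ?posrE//.
rewrite ltr_ln ?posrE ?divr_gt0// ltr_pdivlMr//.
suff : 0 < (t - 1) * (p * t + q) by lra.
by rewrite mulr_gt0 ?subr_gt0//; nra.
Qed.

(** * Monotonicity and intermediate values of [starP], [starH] and [starA] *)

Section monotone.
Variables (R : realType) (p q : R).
Hypotheses (p0 : 0 < p) (q0 : 0 < q).

Lemma starP_incr s t : 1 <= s -> s < t -> p * t < p + 1 ->
  (forall z, s < z < t -> 0 < starP' p q z) -> starP p q s < starP p q t.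
Proof.
move=> s1 st tp; apply: derive_pos_lt => // z /andP[sz zt].
apply: is_derive_starP => //; first exact: le_trans sz.
by apply: le_lt_trans tp; rewrite ler_pM2l.
Qed.

Lemma starP_decr s t : 1 <= s -> s < t -> p * t < p + 1 ->
  (forall z, s < z < t -> starP' p q z < 0) -> starP p q t < starP p q s.
Proof.
move=> s1 st tp; apply: derive_neg_lt => // z /andP[sz zt].
apply: is_derive_starP => //; first exact: le_trans sz.
by apply: le_lt_trans tp; rewrite ler_pM2l.
Qed.

Lemma starH_incr s t : 1 <= s -> s < t -> p * t < p + 1 ->
  (forall z, s < z < t -> 0 < starP' p q z) -> starH p q s < starH p q t.
Proof.
move=> s1 st tp P0; apply: (@derive_pos_lt _ _ (fun z => ln z * starP' p q z)) => // z.
  move=> /andP[sz zt]; apply: is_derive_starH => //; first exact: le_trans sz.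
  by apply: le_lt_trans tp; rewrite ler_pM2l.
move=> szt; rewrite mulr_gt0 ?P0// ln_gt0//; case/andP: szt => sz _.
exact: le_lt_trans sz.
Qed.

Lemma starH_decr s t : 1 <= s -> s < t -> p * t < p + 1 ->
  (forall z, s < z < t -> starP' p q z < 0) -> starH p q t < starH p q s.
Proof.
move=> s1 st tp P0; apply: (@derive_neg_lt _ _ (fun z => ln z * starP' p q z)) => // z.
  move=> /andP[sz zt]; apply: is_derive_starH => //; first exact: le_trans sz.
  by apply: le_lt_trans tp; rewrite ler_pM2l.
move=> szt; rewrite pmulr_rlt0 ?P0// ln_gt0//; case/andP: szt => sz _.
exact: le_lt_trans sz.
Qed.

Let dA s t : 1 < s -> p * t < p + 1 -> forall z, s <= z <= t ->
  is_derive z 1 (starA p q) (starH p q z / (z * ln z ^+ 2)).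
Proof.
move=> s1 tp z /andP[sz zt]; have z1 : 1 < z by exact: lt_le_trans sz.
by apply: is_derive_starA => //; rewrite ?ltW//; apply: le_lt_trans tp; rewrite ler_pM2l.
Qed.

Let den_gt0 (z : R) : 1 < z -> 0 < (z * ln z ^+ 2)^-1.
Proof.
by move=> z1; rewrite invr_gt0 mulr_gt0 ?exprn_gt0 ?ln_gt0// (lt_trans ltr01).
Qed.

Lemma starA_incr s t : 1 < s -> s < t -> p * t < p + 1 ->
  (forall z, s < z < t -> 0 < starH p q z) -> starA p q s < starA p q t.
Proof.
move=> s1 st tp H0; apply: (derive_pos_lt st (dA s1 tp)) => z szt.
by rewrite mulr_gt0 ?H0// den_gt0//; case/andP: szt => /(lt_trans s1).
Qed.

Lemma starA_decr s t : 1 < s -> s < t -> p * t < p + 1 ->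
  (forall z, s < z < t -> starH p q z < 0) -> starA p q t < starA p q s.
Proof.
move=> s1 st tp H0; apply: (derive_neg_lt st (dA s1 tp)) => z szt.
by rewrite pmulr_llt0 ?H0// den_gt0//; case/andP: szt => /(lt_trans s1).
Qed.

Lemma starA_IVT s t a : 1 < s -> s <= t -> p * t < p + 1 ->
  Num.min (starA p q s) (starA p q t) <= a <= Num.max (starA p q s) (starA p q t) ->
  exists2 z, s <= z <= t & starA p q z = a.
Proof. by move=> s1 st tp; apply: (derivable_IVT st (dA s1 tp)). Qed.

Lemma starH_IVT s t a : 1 <= s -> s <= t -> p * t < p + 1 ->
  Num.min (starH p q s) (starH p q t) <= a <= Num.max (starH p q s) (starH p q t) ->
  exists2 z, s <= z <= t & starH p q z = a.
Proof.
move=> s1 st tp; apply: (derivable_IVT st) => z /andP[sz zt].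
apply: is_derive_starH => //; first exact: le_trans sz.
by apply: le_lt_trans tp; rewrite ler_pM2l.
Qed.

Lemma starP_IVT s t a : 1 <= s -> s <= t -> p * t < p + 1 ->
  Num.min (starP p q s) (starP p q t) <= a <= Num.max (starP p q s) (starP p q t) ->
  exists2 z, s <= z <= t & starP p q z = a.
Proof.
move=> s1 st tp; apply: (derivable_IVT st) => z /andP[sz zt].
apply: is_derive_starP => //; first exact: le_trans sz.
by apply: le_lt_trans tp; rewrite ler_pM2l.
Qed.

End monotone.

(** * Sign changes of [starH] and inversion of the profile *)

Lemma starH_sign (R : realType) (p q : R) : 0 < p -> 0 < q ->
  exists2 c : R, 1 <= c /\ p * c < p + 1 &
    [/\ p < q -> 1 < c /\ starH p q c = 0, q <= p -> c = 1,
     forall t, 1 < t -> t < c -> starH p q t < 0 &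
     forall t, c < t -> p * t < p + 1 -> 0 < starH p q t].
Proof.
move=> p0 q0; have [d dp [d1 d1' dneg dpos]] := starP'_sign p0 q0.
(* If q <= p, the turning point d of [starP] is at most 1 and [starH] increases from its value 0 at
   1. Otherwise [starH] decreases from 0 up to d, then increases, and it remains to show that it
   becomes positive. *)
have [qp|pq] := leP q p.
  exists 1; first by split=> //; lra.
  split=> // [t t1 /(lt_trans t1)|t t1 tp]; first by rewrite ltxx.
  rewrite -(starH1 p q); apply: starH_incr => // z /andP[z1 zt].
  by apply: dpos; [exact: ltW|nra|exact: le_lt_trans (d1' qp) z1].
have {d1'}d1 := d1 pq.
have neg t : 1 < t -> t <= d -> starH p q t < 0.
  move=> t1 td; rewrite -(starH1 p q); apply: starH_decr => //; first nra.
  by move=> z /andP[z1 zt]; apply: dneg; [exact: ltW|nra|exact: lt_le_trans td].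
have [s [ds sp As]] := starA_unbounded (starA p q d) p0 q0 (ltW d1) dp.
have incr t t' : d <= t -> t < t' -> p * t' < p + 1 -> starH p q t < starH p q t'.
  move=> dt tt' tp; apply: starH_incr => //; first exact: le_trans (ltW d1) dt.
  move=> z /andP[tz zt]; have dz : d < z by exact: le_lt_trans tz.
  by apply: dpos => //; [exact: ltW (lt_trans d1 dz)|nra].
have Hs : 0 < starH p q s.
  (* Were starH s <= 0, [starH] would be negative on (d, s) and [starA] would decrease there,
     although s was chosen with starA d < starA s. *)
  rewrite ltNge; apply/negP => Hs0; move: As; rewrite ltNge => /negP; apply.
  apply/ltW/starA_decr => // z /andP[dz zs].
  by apply: lt_le_trans Hs0; apply: incr => //; exact: ltW.
have [||||c /andP[dc cs] Hc] := @starH_IVT _ p q p0 q0 d s 0 => //.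
- exact: ltW.
- exact: ltW.
- by rewrite ge_min le_max (ltW Hs) orbT (ltW (neg d _ _)).
have {}dc : d < c.
  by rewrite lt_neqAle dc andbT; apply: contraTneq (neg d d1 (lexx _)) => ->; rewrite Hc ltxx.
exists c; first by split; [exact: ltW (lt_trans d1 dc)|nra].
split=> [_||t t1 tc|t ct tp].
- by split=> //; exact: lt_trans dc.
- by [].
- have [td|dt] := leP t d; first exact: neg.
  by rewrite -Hc; apply: incr => //; [exact: ltW|nra].
- by rewrite -Hc; apply: incr => //; exact: ltW.
Qed.

(* For [p < q] the profile [starA] decreases from [p + q + 1] to its minimum
   [al], then increases to infinity; [tl] and [tr] invert the two branches. *)
Record fold_branches (R : realType) (p q al : R) (tr tl : R -> R) : Prop := {
  fold_al : 1 < al < p + q + 1;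
  fold_tr : forall a, al <= a ->
    [/\ 1 < tr a, p * tr a < p + 1, starA p q (tr a) = a &
        (a < starP p q (tr a)) = (al < a)];
  fold_tr_incr : forall a b, al <= a -> a < b -> tr a < tr b;
  fold_tl : forall a, al < a < p + q + 1 ->
    [/\ 1 < tl a, p * tl a < p + 1, starA p q (tl a) = a &
        starP p q (tl a) < a];
  fold_tl_decr : forall a b, al < a -> a < b -> b < p + q + 1 -> tl b < tl a;
  fold_complete : forall t, 1 < t -> p * t < p + 1 ->
    (al <= starA p q t /\ t = tr (starA p q t)) \/
    (al < starA p q t < p + q + 1 /\ t = tl (starA p q t));
  fold_tr_large : forall t, p * t < p + 1 -> exists M, forall a, M < a -> t < tr a }.

(** For q <= p the profile has no fold: it increases from p + q + 1 to infinity, and one branch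
    inverts it. *)
Record monotone_branch (R : realType) (p q : R) (tr : R -> R) : Prop := {
  monotone_tr : forall a, p + q + 1 < a ->
    [/\ 1 < tr a, p * tr a < p + 1, starA p q (tr a) = a &
        a < starP p q (tr a)];
  monotone_tr_incr : forall a b, p + q + 1 < a -> a < b -> tr a < tr b;
  monotone_complete : forall t, 1 < t -> p * t < p + 1 ->
    p + q + 1 < starA p q t /\ t = tr (starA p q t) }.

Lemma fold_branches_exist (R : realType) (p q : R) : 0 < p -> 0 < q -> p < q ->
  exists al tr tl, fold_branches p q al tr tl.
Proof.
move=> p0 q0 pq; have [c [_ cp] [/(_ pq)[c1 Hc] _ Hneg Hpos]] := starH_sign p0 q0.
have [d dp [/(_ pq) d1 _ dneg dpos]] := starP'_sign p0 q0.
pose A := starA p q; pose N := p + q + 1; pose al := A c.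
have decr s t : 1 < s -> s < t -> t <= c -> A t < A s.
  move=> s1 st tc; apply: starA_decr => //; first nra.
  by move=> z /andP[sz zt]; apply: Hneg; [exact: lt_trans sz|exact: lt_le_trans tc].
have incr s t : c <= s -> s < t -> p * t < p + 1 -> A s < A t.
  move=> cs st tp; apply: starA_incr => //; first exact: lt_le_trans cs.
  by move=> z /andP[sz zt]; apply: Hpos; [exact: le_lt_trans sz|nra].
have Pdecr s t : 1 <= s -> s < t -> t <= d -> starP p q t < starP p q s.
  move=> s1 st td; apply: starP_decr => //; first nra.
  move=> z /andP[sz zt]; apply: dneg; [|nra|exact: lt_le_trans td].
  exact: le_trans s1 (ltW sz).
(* N is the value of [starP] at 1. Up to d, [starP] stays below it and [starA_lt] applies; beyond d,
   [starA] has only decreased further. *)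
have AN t : 1 < t -> t < c -> A t < N.
  move=> t1 tc; have [td|dt] := leP t d.
    apply: starA_lt => //; first nra.
    move=> z /andP[z1 zt]; rewrite /N -(starP1 p q); apply: Pdecr => //.
    by apply: ltW; exact: lt_le_trans td.
  apply: (lt_trans (decr _ _ d1 dt (ltW tc))); apply: starA_lt => //.
  by move=> z /andP[z1 zd]; rewrite /N -(starP1 p q); apply: Pdecr => //; exact: ltW.
(* [xget] picks a preimage of a on each side of c; the default 1 is returned only for a outside the
   range of the branch. *)
pose tr a := xget 1 [set t | [/\ c <= t, p * t < p + 1 & A t = a]].
pose tl a := xget 1 [set t | [/\ 1 < t, t < c & A t = a]].
have trP a : al <= a -> [/\ c <= tr a, p * tr a < p + 1 & A (tr a) = a].
  move=> ala; have [s [cs sp As]] := starA_unbounded a p0 q0 (ltW c1) cp.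
  have [||||z /andP[cz zs] Az] := @starA_IVT _ p q p0 q0 c s a => //.
  - exact: ltW.
  - by rewrite ge_min le_max (ltW As) orbT ala.
  apply: (@xgetPex _ _ [set t | [/\ c <= t, p * t < p + 1 & A t = a]]).
  by exists z; split=> //; nra.
have tlP a : al < a < N -> [/\ 1 < tl a, tl a < c & A (tl a) = a].
  move=> /andP[ala aN].
  (* [starA] is not continuous at 1, so the left end for the intermediate value theorem is built
     from [starP], whose value at 1 is N > a. Either starP d' >= a and d' works, or [starP] takes
     the value a at some z and exceeds it on (1, z), whence a < starA z. *)
  have [s [s1 sc As]] : exists s, [/\ 1 < s, s < c & a < A s].
    pose d' := Num.min d ((1 + c) / 2).
    have d'1 : 1 < d' by rewrite lt_min d1; lra.
    have d'd : d' <= d by rewrite ge_min lexx.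
    have d'c : d' < c by rewrite gt_min; apply/orP; right; lra.
    have d'p : p * d' < p + 1 by nra.
    have [aP|Pa] := leP a (starP p q d').
      exists d'; split=> //; apply: starA_gt => // z /andP[z1 zd].
      by apply: le_lt_trans aP _; apply: Pdecr => //; exact: ltW.
    have [||||z /andP[z1 zd] Pz] := @starP_IVT _ p q p0 q0 1 d' a => //.
    - exact: ltW.
    - by rewrite ge_min le_max (ltW Pa) orbT starP1 (ltW aN).
    have {}z1 : 1 < z.
      rewrite lt_neqAle z1 andbT; apply: contraTneq aN => z1e.
      by rewrite -Pz -z1e starP1 ltxx.
    exists z; split=> //; first exact: le_lt_trans d'c.
    apply: starA_gt => //; first nra.
    move=> y /andP[y1 yz]; rewrite -Pz; apply: Pdecr => //; first exact: ltW.
    exact: le_trans d'd.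
  have [|||z /andP[sz zc] Az] := @starA_IVT _ p q p0 q0 s c a s1 => //.
  - exact: ltW.
  - by rewrite ge_min le_max (ltW As) (ltW ala) orbT.
  apply: (@xgetPex _ _ [set t | [/\ 1 < t, t < c & A t = a]]); exists z; split=> //.
    exact: lt_le_trans sz.
  by rewrite lt_neqAle zc andbT; apply: contraTneq ala => ze; rewrite -Az ze ltxx.
have alN : al < N.
  have m1 : 1 < (1 + c) / 2 by lra.
  have mc : (1 + c) / 2 < c by lra.
  exact: lt_trans (decr _ _ m1 mc (lexx _)) (AN _ m1 mc).
have signP t : 1 < t -> (A t < starP p q t) = (0 < starH p q t) /\
    (starP p q t < A t) = (starH p q t < 0).
  move=> t1; have ln0 : 0 < ln t by rewrite ln_gt0.
  by rewrite starHE// pmulr_rgt0// pmulr_rlt0// subr_gt0 subr_lt0.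
exists al, tr, tl; split.
- by rewrite alN starA_gt1.
- move=> a ala; have [ct tp At] := trP a ala.
  have t1 : 1 < tr a by exact: lt_le_trans ct.
  split=> //; rewrite -{1}At (signP _ t1).1.
  (* If tr a = c, then a = al and starH c = 0, so both strict inequalities fail; to the right of c
     both hold. *)
  move: ct; rewrite le_eqVlt => /predU1P[ct|ct].
    by rewrite -ct Hc ltxx -At -ct ltxx.
  by rewrite Hpos// -At; apply/esym/incr.
- move=> a b ala ab; have [ct tp At] := trP a ala.
  have [cs sp As] := trP b (le_trans ala (ltW ab)).
  rewrite ltNge; apply/negP; rewrite le_eqVlt => /predU1P[e|st].
    by move: ab; rewrite -At -As e ltxx.
  by move: ab; rewrite ltNge => /negP; apply; rewrite -At -As ltW// incr.
- move=> a aN; have [t1 tc At] := tlP a aN.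
  by split=> //; [nra|rewrite -{2}At (signP _ t1).2 Hneg].
- move=> a b ala ab bN; have [t1 tc At] : [/\ 1 < tl a, tl a < c & A (tl a) = a].
    by apply: tlP; rewrite ala (lt_trans ab).
  have [s1 sc As] : [/\ 1 < tl b, tl b < c & A (tl b) = b].
    by apply: tlP; rewrite bN (lt_trans ala).
  rewrite ltNge; apply/negP; rewrite le_eqVlt => /predU1P[e|st].
    by move: ab; rewrite -At -As e ltxx.
  by move: ab; rewrite ltNge => /negP; apply; rewrite -At -As ltW// decr// ltW.
- move=> t t1 tp; have [ct|tc] := leP c t.
    left; have ala : al <= A t.
      by move: ct; rewrite le_eqVlt => /predU1P[<-//|ct]; rewrite ltW// incr.
    split=> //; have [cs sp As] := trP _ ala; have [st|ts|//] := ltgtP t (tr (A t)).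
      by have := incr _ _ ct st sp; rewrite As ltxx.
    by have := incr _ _ cs ts tp; rewrite As ltxx.
  right; have atN : al < A t < N by rewrite AN// decr.
  split=> //; have [s1 sc As] := tlP _ atN; have [st|ts|//] := ltgtP t (tl (A t)).
    by have := decr _ _ t1 st (ltW sc); rewrite As ltxx.
  by have := decr _ _ s1 ts (ltW tc); rewrite As ltxx.
- move=> t tp; pose t' := Num.max t c; have ct' : c <= t' by rewrite le_max lexx orbT.
  have tt' : t <= t' by rewrite le_max lexx.
  have tp' : p * t' < p + 1 by rewrite /t'; case: (leP t c).
  have ala : al <= A t'.
    by move: (ct'); rewrite le_eqVlt => /predU1P[<-//|?]; rewrite ltW// incr.
  exists (A t') => a ta; apply: (le_lt_trans tt').
  have [cs sp As] := trP a (le_trans ala (ltW ta)).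
  rewrite ltNge; apply/negP; rewrite le_eqVlt => /predU1P[e|st].
    by move: ta; rewrite -As e ltxx.
  by move: ta; rewrite ltNge => /negP; apply; rewrite -As ltW// incr.
Qed.

Lemma monotone_branch_exists (R : realType) (p q : R) : 0 < p -> 0 < q -> q <= p ->
  exists tr, monotone_branch p q tr.
Proof.
move=> p0 q0 qp; have [c [_ _] [_ /(_ qp)-> _ Hpos]] := starH_sign p0 q0.
have [d dp [_ /(_ qp) d1 _ dpos]] := starP'_sign p0 q0.
pose A := starA p q; pose N := p + q + 1.
have incr s t : 1 < s -> s < t -> p * t < p + 1 -> A s < A t.
  move=> s1 st tp; apply: starA_incr => // z /andP[sz zt].
  by apply: Hpos; [exact: lt_trans sz|nra].
have Pincr s t : 1 <= s -> s < t -> p * t < p + 1 -> starP p q s < starP p q t.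
  move=> s1 st tp; apply: starP_incr => // z /andP[sz zt].
  have z1 : 1 < z by exact: le_lt_trans sz.
  by apply: dpos; [exact: ltW|nra|exact: le_lt_trans z1].
have NA t : 1 < t -> p * t < p + 1 -> N < A t.
  move=> t1 tp; apply: starA_gt => // z /andP[z1 zt].
  by rewrite /N -(starP1 p q); apply: Pincr => //; nra.
pose tr a := xget 1 [set t | [/\ 1 < t, p * t < p + 1 & A t = a]].
have trP a : N < a -> [/\ 1 < tr a, p * tr a < p + 1 & A (tr a) = a].
  move=> Na; have [||s [s1 sp As]] := @starA_unbounded _ p q 1 a p0 q0 => //; first lra.
  (* As in the folded case, the end near 1 comes from [starP], now increasing from N < a: it takes
     the value a at some z and lies below a on (1, z), so starA z < a. *)
  have [t [t1 ts At]] : exists t, [/\ 1 < t, t < s & A t < a].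
    have aP : a < starP p q s.
      rewrite ltNge; apply/negP => Pa; move: As; rewrite ltNge => /negP; apply.
      apply/ltW/starA_lt => // z /andP[z1 zs]; apply: lt_le_trans Pa.
      by apply: Pincr => //; exact: ltW.
    have [||||z /andP[z1 zs] Pz] := @starP_IVT _ p q p0 q0 1 s a => //.
    - exact: ltW.
    - by rewrite ge_min le_max (ltW aP) orbT starP1 (ltW Na).
    have {}z1 : 1 < z.
      rewrite lt_neqAle z1 andbT; apply: contraTneq Na => z1e.
      by rewrite -Pz -z1e starP1 ltxx.
    have zp : p * z < p + 1 by nra.
    exists z; split=> //.
      by rewrite lt_neqAle zs andbT; apply: contraTneq aP => <-; rewrite Pz ltxx.
    apply: starA_lt => // y /andP[y1 yz].
    by rewrite -Pz; apply: Pincr => //; exact: ltW.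
  have [||||z /andP[sz zc] Az] := @starA_IVT _ p q p0 q0 t s a => //.
  - exact: ltW.
  - by rewrite ge_min le_max (ltW As) (ltW At) orbT.
  apply: (@xgetPex _ _ [set t | [/\ 1 < t, p * t < p + 1 & A t = a]]).
  by exists z; split=> //; [exact: lt_le_trans sz|nra].
exists tr; split.
- move=> a Na; have [t1 tp At] := trP a Na; split=> //.
  have := Hpos _ t1 tp; rewrite starHE// pmulr_rgt0 ?ln_gt0// subr_gt0.
  by rewrite -/(A (tr a)) At.
- move=> a b Na ab; have [t1 tp At] := trP a Na.
  have [s1 sp As] := trP b (lt_trans Na ab).
  rewrite ltNge; apply/negP; rewrite le_eqVlt => /predU1P[e|st].
    by move: ab; rewrite -At -As e ltxx.
  by move: ab; rewrite ltNge => /negP; apply; rewrite -At -As ltW// incr.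
- move=> t t1 tp; have Nt := NA t t1 tp.
  split=> //; have [s1 sp As] := trP _ Nt; have [st|ts|//] := ltgtP t (tr (A t)).
    by have := incr _ _ t1 st sp; rewrite As ltxx.
  by have := incr _ _ s1 ts tp; rewrite As ltxx.
Qed.

(** * The matrix of partial derivatives and its eigenvalues *)

(** The two difference quotients are the same function; one-variable rules then compute the partial
    derivatives. *)
Lemma derive_line (R : realType) (V : normedModType R) (f : V -> R) (v e : V) :
  'D_e f v = 'D_1 (fun h : R => f (h *: e + v)) 0.
Proof.
rewrite /derive; set F := (F in lim (F @ _)); set G := (G in _ = lim (G @ _)).
suff -> : F = G by []; apply/funext => h; rewrite /F /G /=.
by rewrite addr0 scale0r add0r /GRing.scale/= mulr1.
Qed.

Lemma is_derive_powR_affine (R : realType) (a c x : R) : 0 < x ->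
  is_derive (0 : R) 1 (fun h : R => (h * c + x) `^ a) (a * x `^ (a - 1) * c).
Proof.
move=> x0; have x0' : 0 < 0 * c + x by rewrite mul0r add0r.
have dl : is_derive (0 : R) 1 (fun h : R => h * c + x) c.
  by apply: is_derive_eq; rewrite /GRing.scale/=; ring.
have dp : is_derive (0 * c + x) 1 (fun y : R => y `^ a) (a * (0 * c + x) `^ (a - 1)).
  exact: is_derive1_powR.
have := is_derive1_comp (f := fun y : R => y `^ a) (g := fun h : R => h * c + x) dp dl.
by rewrite mul0r add0r.
Qed.

Lemma sum_powR_gt0 (R : realType) (n : nat) (a : R) (v : 'rV[R]_n) :
  (0 < n)%N -> (forall i, 0 < v 0 i) -> 0 < \sum_j v 0 j `^ a.
Proof.
case: n v => // n v _ v0; rewrite big_ord_recl.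
by rewrite ltr_pwDl ?powR_gt0// sumr_ge0// => j _; exact: powR_ge0.
Qed.

Lemma warm_star_DE (R : realType) (n : nat) (a : R) (v : 'rV[R]_n) (i k : 'I_n) :
  (forall i, 0 < v 0 i) ->
  let S := \sum_j v 0 j `^ a in
  warm_star_D a v i k = - (i == k)%:R + n.+1%:R^-1 *
    ((i == k)%:R * (a * v 0 i `^ (a - 1)) / S -
     v 0 i `^ a * (a * v 0 k `^ (a - 1)) / S ^+ 2).
Proof.
move=> v0 S; have S0 : S != 0.
  by rewrite gt_eqF// sum_powR_gt0// (leq_ltn_trans (leq0n i)).
rewrite mxE derive_line.
pose d j : R := (j == k)%:R.
have dp (j : 'I_n) := is_derive_powR_affine a (d j) (v0 j).
have dS := is_derive_sum dp.
have dl : is_derive (0 : R) 1 (fun h : R => h * d i + v 0 i) (d i).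
  by apply: is_derive_eq; rewrite /GRing.scale/=; ring.
pose Sh : R -> R := \sum_j (fun h : R => (h * d j + v 0 j) `^ a).
have Sh0 : Sh 0 = S.
  by rewrite /Sh fct_sumE; apply: eq_bigr => j _; rewrite mul0r add0r.
have Sh00 : Sh 0 != 0 by rewrite Sh0.
have dq := is_derive_div Sh00 (dp i) dS.
have -> : (fun h : R => warm_star_field a (h *: delta_mx 0 k + v) 0 i) =
   (fun h : R => (- (h * d i + v 0 i) + n.+1%:R^-1)
     + n.+1%:R^-1 * ((h * d i + v 0 i) `^ a / Sh h)).
  apply/funext => h; rewrite !mxE /Sh fct_sumE eqxx /= /d.
  congr (_ + _ * (_ / _)); apply: eq_bigr => j _.
  by rewrite !mxE eqxx.
have dtot : is_derive (0 : R) 1 (fun h : R => (- (h * d i + v 0 i) + n.+1%:R^-1)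
     + n.+1%:R^-1 * ((h * d i + v 0 i) `^ a / Sh h))
   (- d i + n.+1%:R^-1 * ((a * v 0 i `^ (a - 1) * d i * Sh 0 -
      (0 * d i + v 0 i) `^ a * (\sum_j a * v 0 j `^ (a - 1) * d j)) / Sh 0 ^+ 2)).
  by apply: is_derive_eq; rewrite /GRing.scale/=; ring.
rewrite (@derive_val _ _ _ _ _ _ _ dtot) Sh0 mul0r add0r (bigD1 k)//= big1 ?addr0; last first.
  by move=> j /negPf jk; rewrite /d jk mulr0.
by rewrite /d eqxx mulr1; congr (_ + _ * _); field.
Qed.

(** Multiplying F_i = 0 by N = n + 1 gives N v_i = 1 + v_i^a / S with a nonnegative quotient, so no
    coordinate of an equilibrium vanishes. *)
Lemma equilibriumE (R : realType) (n : nat) (a : R) (v : 'rV[R]_n) : (0 < n)%N ->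
  equilibrium a v <->
  [/\ forall i, 0 < v 0 i, \sum_i v 0 i = 1 &
      forall i, n.+1%:R * v 0 i - 1 = v 0 i `^ a / \sum_j v 0 j `^ a].
Proof.
move=> n0; have N0 : 0 < n.+1%:R :> R by rewrite ltr0n.
split=> [[[v0 v1] Fv]|[v0 v1 vE]]; last first.
  split; first by split=> // i; exact: ltW.
  apply/rowP => i; rewrite !mxE -vE; move: N0; set N := n.+1%:R => N0.
  by field; rewrite gt_eqF.
have vE i : n.+1%:R * v 0 i - 1 = v 0 i `^ a / \sum_j v 0 j `^ a.
  have /rowP/(_ i) := Fv; rewrite !mxE; set q := _ / _.
  move: N0; set N := n.+1%:R => N0 e.
  have : N * (- v 0 i + N^-1 + N^-1 * q) = 0 by rewrite e mulr0.
  by rewrite mulrDr mulrA !mulrDr !divff ?gt_eqF// mul1r; lra.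
split=> // i; suff : 0 < n.+1%:R * v 0 i by rewrite pmulr_rgt0.
have : 0 <= v 0 i `^ a / \sum_j v 0 j `^ a.
  by rewrite divr_ge0 ?powR_ge0// sumr_ge0// => j _; exact: powR_ge0.
by rewrite -vE; lra.
Qed.

(** At an equilibrium v_i^a / S = N v_i - 1 = v_i d_i and v_i^(a - 1) / S = d_i, which removes all
    powers from the matrix. *)
Lemma equilibrium_DE (R : realType) (n : nat) (a : R) (v : 'rV[R]_n) (i k : 'I_n) :
  equilibrium a v ->
  let d j := n.+1%:R - (v 0 j)^-1 in
  warm_star_D a v i k = - (i == k)%:R + a / n.+1%:R *
    ((i == k)%:R * d i - v 0 i * d i * d k).
Proof.
have n0 : (0 < n)%N by rewrite (leq_ltn_trans (leq0n i)).
move=> /(equilibriumE _ _ n0)[v0 _ vE] d; rewrite warm_star_DE//.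
set S := \sum_j _ in vE *; have S0 : S != 0 by rewrite gt_eqF// sum_powR_gt0.
have pS j : v 0 j `^ a / S = v 0 j * d j.
  by rewrite -vE /d mulrBr divff ?gt_eqF// mulrC.
have pS' j : v 0 j `^ (a - 1) / S = d j.
  rewrite powRB; last by rewrite (gt_eqF (v0 j)) implybT.
  rewrite powRr1 ?ltW//.
  by rewrite mulrAC pS mulrAC divff ?mul1r ?gt_eqF.
rewrite -[v 0 i * d i]pS -!pS' [a / _]mulrC -[_ * a * _]mulrA; congr (_ + _ * _).
by field.
Qed.

(** These are the left eigenvector equations of diag d - p d^T, with d constant off i0. Multiplying
    c = sum x_i p_i by du - mu and eliminating the x_j leaves c mu (mu - (p_i0 du + (1 - p_i0)
    d_i0)) = 0. *)
Lemma eigenvalue_rank_one (F : fieldType) (n : nat) (p d x : 'I_n -> F) (i0 : 'I_n)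
    (du mu : F) :
  (forall j, j != i0 -> d j = du) -> \sum_j p j = 1 -> p i0 != 0 ->
  (forall j, d j * x j - (\sum_i x i * p i) * d j = mu * x j) ->
  (exists j, x j != 0) ->
  [\/ mu = 0, mu = du | mu = p i0 * du + (1 - p i0) * d i0].
Proof.
move=> dE p1 p0 xE [j0 xj0]; set c := \sum_i _ in xE.
have [->|mu0] := eqVneq mu 0; first by constructor 1.
have [->|mudu] := eqVneq mu du; first by constructor 2.
have dumu : du - mu != 0 by rewrite subr_eq0 eq_sym.
have xu j : j != i0 -> (du - mu) * x j = c * du.
  by move=> ji; rewrite mulrBl -xE dE//; ring.
have xv : (d i0 - mu) * x i0 = c * d i0 by rewrite mulrBl -xE; ring.
have cE : c * (du - mu) = p i0 * x i0 * (du - mu) + (1 - p i0) * (c * du).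
  rewrite {1}/c (bigD1 i0)//= mulrDl [x i0 * _]mulrC; congr (_ + _).
  have -> : 1 - p i0 = \sum_(j | j != i0) p j by rewrite -p1 (bigD1 i0)//=; ring.
  rewrite [LHS]mulr_suml [RHS]mulr_suml; apply: eq_bigr => j ji.
  by rewrite -(xu _ ji); ring.
have : c * (mu * (mu - (p i0 * du + (1 - p i0) * d i0))) = 0.
  have e1 : p i0 * x i0 * (du - mu) = c * (p i0 * du - mu).
    by apply: (addIr ((1 - p i0) * (c * du))); rewrite -cE; ring.
  have e2 : (d i0 - mu) * (p i0 * x i0 * (du - mu)) = p i0 * (du - mu) * (c * d i0).
    by rewrite -xv; ring.
  apply: (addIr ((d i0 - mu) * (p i0 * x i0 * (du - mu)))).
  by rewrite {1}e2 e1; ring.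
move=> /eqP; rewrite mulf_eq0 => /predU1P[c0|].
  (* If c = 0 and mu != du, then x vanishes off i0, and at i0 too because p_i0 != 0; so x would be
     zero. *)
  case/eqP: xj0; have [->|ji] := eqVneq j0 i0.
    apply/eqP; move/esym/eqP: cE.
    by rewrite c0 !mul0r mulr0 addr0 !mulf_eq0 (negPf p0) (negPf dumu) orbF.
  by apply/eqP; move/eqP: (xu _ ji); rewrite c0 mul0r mulf_eq0 (negPf dumu).
by rewrite mulf_eq0 (negPf mu0) subr_eq0/= => /eqP ->; constructor 3.
Qed.

(** With b = a / N, the number mu = (z + 1) / b is an eigenvalue of diag d - r d^T over R[i], and
    [eigenvalue_rank_one] confines it to three real values. *)
Lemma complex_eigenvalue_equilibrium (R : realType) (n : nat) (a : R) (v : 'rV[R]_n)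
    (i0 : 'I_n) (u : R) (z : R[i]) : 0 < a -> equilibrium a v ->
  (forall j, j != i0 -> v 0 j = u) ->
  let du := n.+1%:R - u^-1 in let dv := n.+1%:R - (v 0 i0)^-1 in
  let p := n.+1%:R * v 0 i0 - 1 in
  complex_eigenvalue (warm_star_D a v) z ->
  exists2 mu : R, [\/ mu = 0, mu = du | mu = p * du + (1 - p) * dv] &
    z = real_complex R (a / n.+1%:R * mu - 1).
Proof.
move=> a0 eqv vu du dv p /eigenvalueP[x xD x0].
have n0 : (0 < n)%N by rewrite (leq_ltn_trans (leq0n i0)).
have [v0 v1 vE] := (equilibriumE a v n0).1 eqv.
have N0 : n.+1%:R != 0 :> R by rewrite pnatr_eq0.
pose d j := n.+1%:R - (v 0 j)^-1; pose b := a / n.+1%:R.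
have b0 : b != 0 by rewrite mulf_neq0 ?invr_eq0// gt_eqF.
have pd j : n.+1%:R * v 0 j - 1 = v 0 j * d j.
  by rewrite /d mulrBr divff ?gt_eqF// mulrC.
pose bC := real_complex R b; pose dC j := real_complex R (d j).
pose pC j := real_complex R (n.+1%:R * v 0 j - 1).
have bC0 : bC != 0 by rewrite fmorph_eq0.
pose mu := (z + 1) / bC.
have zE : z = bC * mu - 1 by rewrite /mu mulrC divfK// addrK.
have DE i j : real_complex R (warm_star_D a v i j) =
    - (i == j)%:R + bC * ((i == j)%:R * dC i - pC i * dC j).
  rewrite equilibrium_DE// -/(d i) -/(d j) -pd -/b.
  by rewrite /bC /pC /dC /b !(rmorphB, rmorphD, rmorphN, rmorphM, rmorph_nat).
have xE j : dC j * x 0 j - (\sum_i x 0 i * pC i) * dC j = mu * x 0 j.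
  apply: (mulfI bC0); have /rowP/(_ j) := xD; rewrite !mxE zE.
  under eq_bigr => i _.
    rewrite mxE DE.
    have -> : x 0 i * (- (i == j)%:R + bC * ((i == j)%:R * dC i - pC i * dC j)) =
      (i == j)%:R * (x 0 i * (bC * dC i - 1)) - bC * (x 0 i * pC i * dC j) by ring.
    over.
  rewrite sumrB (bigD1 j)//= eqxx mul1r big1 ?addr0; last first.
    by move=> i /negPf ->; rewrite mul0r.
  rewrite -mulr_sumr -mulr_suml => e.
  have -> : bC * (dC j * x 0 j - (\sum_i x 0 i * pC i) * dC j) =
    (x 0 j * (bC * dC j - 1) - bC * ((\sum_i x 0 i * pC i) * dC j)) + x 0 j by ring.
  by rewrite e; ring.
have := @eigenvalue_rank_one _ n pC dC (x 0) i0 (real_complex R du) mu.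
case=> //.
- by move=> j ji; rewrite /dC /d vu.
(* The weights N v_i - 1 sum to N - n = 1. *)
- rewrite /pC -rmorph_sum sumrB -mulr_sumr v1 sumr_const card_ord mulr1.
  by rewrite -natr1 [_ + 1]addrC addrK rmorph1.
- by rewrite fmorph_eq0 vE gt_eqF// divr_gt0 ?powR_gt0// sum_powR_gt0.
- by have /rV0Pn := x0.
- by move=> m0; exists 0; [constructor 1|rewrite zE m0 mulr0 mulr0 !sub0r rmorphN rmorph1].
- move=> m0; exists du; first by constructor 2.
  by rewrite zE m0 [RHS]rmorphB [in RHS]rmorphM rmorph1.
- move=> m0; exists (p * du + (1 - p) * dv); first by constructor 3.
  have rcE (r s t : R) : real_complex R (r * s + (1 - r) * t) =
      real_complex R r * real_complex R s + (1 - real_complex R r) * real_complex R t.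
    by rewrite rmorphD !rmorphM rmorphB rmorph1.
  by rewrite zE m0 -rcE [RHS]rmorphB [in RHS]rmorphM rmorph1.
Qed.

(** * Two-valued equilibria *)

(** For an equilibrium K = - ln S. Conversely N v_i - 1 = exp(K) v_i^a, and summing over i gives 1 =
    exp(K) S, so the normalisation recovers K. *)
Lemma equilibrium_lnP (R : realType) (n : nat) (a : R) (v : 'rV[R]_n) : (0 < n)%N ->
  equilibrium a v <->
  \sum_i v 0 i = 1 /\ exists K, forall i, 1 < n.+1%:R * v 0 i /\
    ln (n.+1%:R * v 0 i - 1) - a * ln (v 0 i) = K.
Proof.
move=> n0; rewrite equilibriumE//; split=> [[v0 v1 vE]|[v1 [K vK]]].
  split=> //; exists (- ln (\sum_j v 0 j `^ a)) => i.
  have S0 := sum_powR_gt0 a n0 v0.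
  split; first by rewrite -subr_gt0 vE divr_gt0 ?powR_gt0.
  by rewrite vE ln_div ?posrE ?powR_gt0// ln_powR; ring.
have v0 i : 0 < v 0 i.
  have [/(lt_trans ltr01) + _] := vK i; rewrite pmulr_rgt0// ltr0n//.
have vE i : n.+1%:R * v 0 i - 1 = expR K * v 0 i `^ a.
  have [v1' <-] := vK i; rewrite /powR gt_eqF// -expRD subrK lnK// posrE.
  by rewrite subr_gt0.
split=> // i; rewrite vE mulrC; congr (_ * _).
have : expR K * \sum_j v 0 j `^ a = 1.
  rewrite mulr_sumr; under eq_bigr do rewrite -vE.
  by rewrite sumrB -mulr_sumr v1 sumr_const card_ord mulr1 -natr1; ring.
move=> KS; have S0 : \sum_j v 0 j `^ a != 0 by rewrite gt_eqF// sum_powR_gt0.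
by apply: (mulIf S0); rewrite KS mulVf.
Qed.

Lemma star_Rolle (R : realType) (N a x y : R) : 0 < N -> x < y -> 1 < N * x ->
  ln (N * x - 1) - a * ln x = ln (N * y - 1) - a * ln y ->
  exists2 z, x < z < y & N * z = a * (N * z - 1).
Proof.
move=> N0 xy Nx e; have x0 : 0 < x by rewrite -(pmulr_rgt0 _ N0) (lt_trans ltr01).
have [|z xzy] := @mean_value R (fun x => ln (N * x - 1) - a * ln x)
    (fun z => N / (N * z - 1) - a / z) x y xy.
  move=> z /andP[xz zy]; have z0 : 0 < z by exact: lt_le_trans xz.
  have Nz : 0 < N * z - 1 by rewrite subr_gt0; nra.
  have d1 : is_derive z 1 (fun z => N * z - 1) N.
    by apply: is_derive_eq; rewrite /GRing.scale/=; ring.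
  have dl := is_derive_ln_comp (f := fun z => N * z - 1) Nz d1.
  have dln := is_derive1_ln z0.
  have dal : is_derive z 1 (fun z => a * ln z) (a / z).
    by apply: is_derive_eq; rewrite /GRing.scale/=; ring.
  exact: is_deriveB.
have /andP[xz zy] := xzy.
rewrite -e subrr => /esym/eqP; rewrite mulf_eq0 [y - x == 0]subr_eq0 (gt_eqF xy) orbF.
have z0 : 0 < z by exact: lt_trans xz.
have Nz : 0 < N * z - 1 by rewrite subr_gt0; nra.
rewrite subr_eq0 eqr_div ?(gt_eqF Nz) ?(gt_eqF z0)// => /eqP; by exists z.
Qed.

(** Three distinct values would give, by [star_Rolle], two distinct solutions of N z = a (N z - 1),
    an affine equation with a single root when a > 1. *)
Lemma equilibrium_two_values (R : realType) (n : nat) (a : R) (w : 'rV[R]_n)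
    (i j l : 'I_n) : 1 < a -> equilibrium a w -> w 0 i < w 0 j ->
  w 0 l = w 0 i \/ w 0 l = w 0 j.
Proof.
have n0 : (0 < n)%N by rewrite (leq_ltn_trans (leq0n i)).
have N0 : 0 < n.+1%:R :> R by rewrite ltr0n.
move=> a1 /(equilibrium_lnP _ _ n0)[_ [K wK]].
have no3 x y z : w 0 x < w 0 y -> w 0 y < w 0 z -> False.
  have [[x1 xK] [y1 yK] [z1 zK]] := And3 (wK x) (wK y) (wK z).
  move=> xy yz; have [|s /andP[_ sy] sE] := star_Rolle (a := a) N0 xy x1.
    by rewrite xK.
  have [|t /andP[yt _] tE] := star_Rolle (a := a) N0 yz y1; first by rewrite yK.
  have st : s < t by exact: lt_trans yt.
  have : 0 < (a - 1) * n.+1%:R * (t - s) by rewrite !mulr_gt0// subr_gt0.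
  by move: N0 sE tE; set N := n.+1%:R => N0 sE tE; lra.
move=> ij; have [li|il|->] := ltgtP (w 0 l) (w 0 i); last by left.
  by case: (no3 l i j).
have [lj|jl|->] := ltgtP (w 0 l) (w 0 j); last by right.
  by case: (no3 i l j).
by case: (no3 i j l).
Qed.

Lemma sum_two_values (R : pzRingType) (n : nat) (A : {set 'I_n}) (x y : R) :
  \sum_i (if i \in A then x else y) = #|A|%:R * x + (n - #|A|)%:R * y.
Proof.
rewrite (bigID (mem A))/=; congr (_ + _).
  rewrite (eq_bigr (fun=> x)) ?sumr_const ?mulr_natl// => i /= iA.
  by rewrite ifT.
rewrite (eq_bigr (fun=> y)) => [|i /negPf iA]; last by rewrite ifF.
rewrite sumr_const mulr_natl; congr (_ *+ _).
by rewrite -[X in (X - _)%N]card_ord -(cardC (mem A)) addKn; apply: eq_card => i; rewrite !inE.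
Qed.

Lemma two_block_perm (R : realType) (n k : nat) (v u : R) (w : 'rV[R]_n) : (k <= n)%N ->
  equal_up_to_perm w (two_block n k v u) <->
  exists2 A : {set 'I_n}, #|A| = k & forall i, w 0 i = if i \in A then v else u.
Proof.
move=> kn; have cardk : #|[set i : 'I_n | (i < k)%N]%SET| = k.
  by rewrite cardsE -sum1_card -[RHS]card_ord -sum1_card (big_ord_widen_cond n predT (fun=> 1%N)).
split=> [[s ->]|[A Ak wA]].
  exists (s @^-1: [set i : 'I_n | (i < k)%N]%SET).
    by rewrite card_preimset//; exact: perm_inj.
  by move=> i; rewrite !mxE !inE.
(* Membership in A and membership in the first k indices are boolean tuples with equally many true
   entries, hence permutations of each other. *)
pose ts : n.-tuple bool := [tuple i \in A | i < n].
pose tk : n.-tuple bool := [tuple (i < k)%N | i < n].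
have count_true (P : pred 'I_n) :
    count_mem true (map P (enum 'I_n)) = #|[set i | P i]%SET|.
  rewrite count_map cardsE cardE -size_filter /enum_mem filter_predT; congr size.
  by rewrite -enumT; apply: eq_filter => i; rewrite /= eqb_id.
have count_false (P : pred 'I_n) :
    count_mem false (map P (enum 'I_n)) = (n - #|[set i | P i]%SET|)%N.
  have := count_predC (pred1 true) (map P (enum 'I_n)).
  rewrite size_map size_enum_ord count_true => e.
  rewrite -[X in (X - _)%N]e addKn; by apply: eq_count => -[].
have /tuple_permP[s sE] : perm_eq ts tk.
  apply/allP => b _ /=; case: b; rewrite ?count_true ?count_false cardk.
    by rewrite -Ak; apply/eqP/eq_card => i; rewrite !inE.
  by rewrite -Ak; apply/eqP; congr (_ - _)%N; apply: eq_card => i; rewrite !inE.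
exists s; apply/rowP => i; rewrite wA !mxE.
have := congr1 (fun t => tnth t i) (val_inj sE).
by rewrite !tnth_mktuple => ->.
Qed.

(** Explicit real left eigenvectors of diag d - r d^T yield eigenvalues of D, and thereby necessary
    conditions for stability. *)
Lemma complex_eigenvalue_real (R : realType) (n : nat) (a : R) (v x : 'rV[R]_n)
    (mu : R) : equilibrium a v -> x != 0 ->
  (forall j, (n.+1%:R - (v 0 j)^-1) * x 0 j -
     (\sum_i x 0 i * (n.+1%:R * v 0 i - 1)) * (n.+1%:R - (v 0 j)^-1) = mu * x 0 j) ->
  complex_eigenvalue (warm_star_D a v) (real_complex R (a / n.+1%:R * mu - 1)).
Proof.
move=> eqv x0 xE; rewrite /complex_eigenvalue eigenvalue_map.
apply/eigenvalueP; exists x => //; apply/rowP => j; rewrite !mxE.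
have n0 : (0 < n)%N by rewrite (leq_ltn_trans (leq0n j)).
have [v0 _ _] := (equilibriumE a v n0).1 eqv.
pose b := a / n.+1%:R; pose d j := n.+1%:R - (v 0 j)^-1.
pose p j := n.+1%:R * v 0 j - 1.
under eq_bigr => i _.
  rewrite equilibrium_DE// -/b -/(d i) -/(d j).
  have -> : v 0 i * d i = p i.
    by rewrite /p /d mulrBr divff ?gt_eqF// mulrC.
  have -> : x 0 i * (- (i == j)%:R + b * ((i == j)%:R * d i - p i * d j)) =
    (i == j)%:R * (x 0 i * (b * d i - 1)) - b * (x 0 i * p i * d j) by ring.
  over.
rewrite sumrB (bigD1 j)//= eqxx mul1r big1 ?addr0; last first.
  by move=> i /negPf ->; rewrite mul0r.
rewrite -mulr_sumr -mulr_suml -/b.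
have -> : (b * mu - 1) * x 0 j = b * (mu * x 0 j) - x 0 j by ring.
by rewrite -xE -/(d j) /p; ring.
Qed.

(** Equal coordinates have equal weights N v - 1, so e_i - e_j is orthogonal to r and is a left
    eigenvector of diag d - r d^T with eigenvalue N - 1 / v_i. *)
Lemma not_stable_equal_coordinates (R : realType) (n : nat) (a : R) (v : 'rV[R]_n)
    (i j : 'I_n) : equilibrium a v -> i != j -> v 0 i = v 0 j ->
  n.+1%:R <= a * (n.+1%:R - (v 0 i)^-1) -> ~ linearly_stable a v.
Proof.
move=> eqv ij vij Na st; pose mu := n.+1%:R - (v 0 i)^-1.
pose x : 'rV[R]_n := delta_mx 0 i - delta_mx 0 j.
suff /st/= : complex_eigenvalue (warm_star_D a v)
    (real_complex R (a / n.+1%:R * mu - 1)).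
  by rewrite subr_lt0 mulrAC ltr_pdivrMr ?ltr0n// mul1r ltNge Na.
apply: (@complex_eigenvalue_real _ _ _ _ x) => //.
  apply/negP => /eqP x0; have := congr1 (fun y : 'rV[R]_n => y 0 i) x0.
  by rewrite !mxE !eqxx (negPf ij) subr0 => /eqP; rewrite oner_eq0.
have -> : \sum_l x 0 l * (n.+1%:R * v 0 l - 1) = 0.
  under eq_bigr => l _ do rewrite !mxE eqxx/= mulrBl.
  rewrite sumrB (bigD1 i)//= eqxx big1 ?addr0; last first.
    by move=> l /negPf ->; rewrite mul0r.
  rewrite (bigD1 j)//= eqxx big1 ?addr0; last first.
    by move=> l /negPf ->; rewrite mul0r.
  by rewrite vij subrr.
move=> l; rewrite !mxE eqxx mul0r subr0/=.
have [->//|li] := eqVneq l i; have [->|lj] := eqVneq l j.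
  by rewrite /mu vij.
by rewrite subrr !mulr0.
Qed.

(** * Stability of the uniform equilibrium *)

Lemma const_equilibrium (R : realType) (n : nat) (a : R) : (0 < n)%N ->
  equilibrium a (const_mx n%:R^-1 : 'rV[R]_n).
Proof.
move=> n0; have n0' : 0 < n%:R :> R by rewrite ltr0n.
have s1 : \sum_(i < n) (const_mx n%:R^-1 : 'rV[R]_n) 0 i = 1.
  under eq_bigr do rewrite mxE.
  by rewrite sumr_const card_ord -[n%:R^-1 *+ n]mulr_natl divff// gt_eqF.
apply/(equilibrium_lnP _ _ n0); split=> //.
exists (ln (n.+1%:R / n%:R - 1) - a * ln n%:R^-1) => i; rewrite mxE.
by split=> //; rewrite ltr_pdivlMr// mul1r ltr_nat.
Qed.

(** Here every d_j equals N - n = 1, so mu can only be 0 or 1. *)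
Lemma const_eigenvalue (R : realType) (n : nat) (a : R) (z : R[i]) : (1 < n)%N -> 0 < a ->
  complex_eigenvalue (warm_star_D a (const_mx n%:R^-1 : 'rV[R]_n)) z ->
  z = -1 \/ z = real_complex R (a / n.+1%:R - 1).
Proof.
move=> n1 a0; have n0 : (0 < n)%N by exact: ltnW.
pose i0 := Ordinal n0 => zeig.
have [//|mu muE ->] := @complex_eigenvalue_equilibrium _ _ _ _ i0 n%:R^-1 _ a0
  (const_equilibrium a n0) _ zeig; first by move=> j _; rewrite mxE.
have d1 : n.+1%:R - n%:R = 1 :> R by rewrite -natr1; ring.
rewrite mxE !invrK d1 in muE; case: muE => ->; [left|right|right].
- by rewrite mulr0 sub0r rmorphN rmorph1.
- by rewrite mulr1.
- by congr (real_complex R _); ring.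
Qed.

Lemma const_stable (R : realType) (n : nat) (a : R) : (1 < n)%N -> 0 < a ->
  linearly_stable a (const_mx n%:R^-1 : 'rV[R]_n) <-> a < n.+1%:R.
Proof.
move=> n1 a0; have n0 : (0 < n)%N by exact: ltnW.
split=> [st|aN z /(const_eigenvalue n1 a0)[->|->]/=]; last 2 first.
- by rewrite oppr_lt0.
- by rewrite subr_lt0 ltr_pdivrMr ?ltr0n// mul1r.
rewrite ltNge; apply/negP => Na; move: st.
apply: (@not_stable_equal_coordinates _ _ _ _ (Ordinal n0) (Ordinal n1)) => //.
- exact: const_equilibrium.
- by rewrite !mxE.
- by rewrite mxE invrK -natr1 addrAC subrr add0r mulr1 natr1.
Qed.

Lemma const_critical (R : realType) (n : nat) : (1 < n)%N ->
  critical n.+1%:R (const_mx n%:R^-1 : 'rV[R]_n).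
Proof.
move=> n1; have N0 : 0 < n.+1%:R :> R by rewrite ltr0n.
split=> [/(const_stable n1 N0)|]; first by rewrite ltxx.
move=> [z /(const_eigenvalue n1 N0)[->|->]]/=; first by rewrite oppr_gt0 ltr10.
by rewrite divff ?gt_eqF// subrr ltxx.
Qed.

(** * Equation and stability of equilibria with value ratio t *)

Section two_valued.
Variables (R : realType) (n : nat) (A : {set 'I_n}) (t : R) (w : 'rV[R]_n).
Hypotheses (A0 : (0 < #|A|)%N) (An : (#|A| < n)%N) (t1 : 1 < t).
Let p : R := #|A|%:R.
Let q : R := (n - #|A|)%:R.
Let u : R := (p * t + q)^-1.
Hypothesis wE : forall i, w 0 i = if i \in A then t * u else u.

Let N : R := n.+1%:R.

Let NE : N = p + q + 1.
Proof. by rewrite /N /p /q -natrD subnKC ?natr1// ltnW. Qed.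

Let p0 : 0 < p. Proof. by rewrite ltr0n. Qed.
Let q0 : 0 < q. Proof. by rewrite ltr0n subn_gt0. Qed.
Let D0 : 0 < p * t + q.
Proof. by rewrite addr_gt0 ?mulr_gt0// (lt_trans ltr01). Qed.
Let u0 : 0 < u. Proof. by rewrite invr_gt0. Qed.
Let n0 : (0 < n)%N. Proof. exact: leq_ltn_trans An. Qed.

Let Nu : N * u - 1 = (p + 1 - p * t) * u.
Proof. by rewrite NE /u; field; rewrite gt_eqF. Qed.

Let Nv : N * (t * u) - 1 = ((q + 1) * t - q) * u.
Proof. by rewrite NE /u; field; rewrite gt_eqF. Qed.

Lemma two_valued_in : exists2 i, i \in A & w 0 i = t * u.
Proof. by have /card_gt0P[i iA] := A0; exists i => //; rewrite wE iA. Qed.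

Lemma two_valued_out : exists2 i, i \notin A & w 0 i = u.
Proof.
have cA : (0 < #|[predC A]|)%N.
  by rewrite -(ltn_add2l #|A|) addn0 (cardC (mem A)) card_ord.
by have /card_gt0P[i iA] := cA; rewrite inE in iA; exists i => //; rewrite wE (negPf iA).
Qed.

(** The quantity ln (N x - 1) - a ln x must agree at x = u and x = t u; the terms in ln u cancel and
    starL = a ln t remains. The bound on t is the positivity of N u - 1. *)
Lemma two_valued_equilibrium (a : R) :
  equilibrium a w <-> p * t < p + 1 /\ starA p q t = a.
Proof.
have t0 : 0 < t by exact: lt_trans t1.
have v1 : 0 < (q + 1) * t - q by apply: affine_gt0 => //; exact: ltW.
rewrite equilibrium_lnP// -/N.
have lnv : p * t < p + 1 -> ln (N * (t * u) - 1) - a * ln (t * u) =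
    ln ((q + 1) * t - q) + ln u - a * (ln t + ln u).
  by move=> tp; rewrite Nv !lnM ?posrE.
have lnu : p * t < p + 1 -> ln (N * u - 1) - a * ln u =
    ln (p + 1 - p * t) + ln u - a * ln u.
  by move=> tp; rewrite Nu !lnM ?posrE// subr_gt0.
split=> [[_ [K wK]]|[tp tA]].
  have [i iA wi] := two_valued_in; have [j jA wj] := two_valued_out.
  have [_ iK] := wK i; have [j1 jK] := wK j.
  have tp : p * t < p + 1.
    by move: j1; rewrite wj -subr_gt0 Nu pmulr_lgt0// subr_gt0.
  split=> //; apply/starAE => //; move: iK jK.
  by rewrite wi wj lnv// lnu// /starL; lra.
split.
  under eq_bigr do rewrite wE.
  by rewrite sum_two_values -/p -/q /u; field; rewrite gt_eqF.
exists (ln (N * u - 1) - a * ln u) => i; rewrite wE; case: ifP => _.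
  split; first by rewrite -subr_gt0 Nv mulr_gt0.
  by move/starAE: tA => /(_ t1); rewrite lnv// lnu// /starL; lra.
by split=> //; rewrite -subr_gt0 Nu mulr_gt0// subr_gt0.
Qed.

Variable a : R.
Hypotheses (a1 : 1 < a) (weq : equilibrium a w).

Let du : R := p + 1 - p * t.
Let dv : R := ((q + 1) * t - q) / t.

Let t0 : 0 < t. Proof. exact: lt_trans t1. Qed.
Let du0 : 0 < du.
Proof. by rewrite subr_gt0; have [] := (two_valued_equilibrium a).1 weq. Qed.
Let dv0 : 0 < dv. Proof. by rewrite divr_gt0// affine_gt0// ltW. Qed.
Let N0 : 0 < N. Proof. by rewrite ltr0n. Qed.

Let duE : N - u^-1 = du. Proof. by rewrite NE invrK /du; ring. Qed.
Let dvE : N - (t * u)^-1 = dv.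
Proof. by rewrite NE invfM invrK /dv; field; rewrite gt_eqF. Qed.

(** Rolle gives z between u and t u with N = a (N - 1 / z). The map N - 1 / x increases in x and
    takes the values [du] at u and [dv] at t u. *)
Lemma two_valued_Rolle : a * du < N < a * dv.
Proof.
have [i iA wi] := two_valued_in; have [j jA wj] := two_valued_out.
have [_ [K wK]] := (equilibrium_lnP a w n0).1 weq.
have [_ iK] := wK i; have [j1 jK] := wK j.
have utu : u < t * u by rewrite ltr_pMl.
have [||z /andP[uz zv] zE] := star_Rolle (a := a) N0 utu.
- by rewrite -wj.
- by rewrite -wi -wj jK iK.
have z0 : 0 < z by exact: lt_trans uz.
have a0 : 0 < a by exact: lt_trans a1.
have {1 2}-> : N = a * (N - z^-1).
  by apply: (mulIf (lt0r_neq0 z0)); rewrite zE; field; rewrite gt_eqF.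
rewrite !ltr_pM2l// -duE -dvE !ltrD2l !ltrN2.
by rewrite !ltf_pV2 ?posrE ?mulr_gt0// uz zv.
Qed.

Lemma starP_du_dv : starP p q t * (du * dv) = N.
Proof.
rewrite /starP NE /dv /du; have := affine_gt0 q0 (ltW t1); have := du0; rewrite /du.
by move=> d1 d2; field; rewrite !gt_eqF.
Qed.

Let coord_card1 : #|A| = 1%N -> exists2 i0, A = [set i0]%SET & w 0 i0 = t * u.
Proof.
move=> /eqP/cards1P[i0 AE]; exists i0 => //.
by rewrite wE AE inE eqxx.
Qed.

(* [du * dv] is the eigenvalue carried by the vectors that are constant on each
   of the two blocks. *)
Let block_eigenvalue : #|A| = 1%N ->
  (N * (t * u) - 1) * du + (1 - (N * (t * u) - 1)) * dv = du * dv.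
Proof.
move=> A1; have pE : p = 1 by rewrite /p A1.
have tq : t + q != 0 by rewrite gt_eqF// addr_gt0.
by rewrite Nv /u /du /dv pE; field; rewrite (gt_eqF t0).
Qed.

Lemma two_valued_not_stable : (1 < #|A|)%N -> ~ linearly_stable a w.
Proof.
move=> /card_gt1P[i [j [iA jA ij]]]; have [_ adv] := andP two_valued_Rolle.
apply: (@not_stable_equal_coordinates _ _ _ _ i j) => //; rewrite ?wE ?iA ?jA//.
by rewrite dvE ltW.
Qed.

Lemma two_valued_singleton_stable : #|A| = 1%N ->
  linearly_stable a w <-> a < starP p q t.
Proof.
move=> A1; have [i0 AE wi0] := coord_card1 A1; have a0 : 0 < a by exact: lt_trans a1.
have wj j : j != i0 -> w 0 j = u by move=> /negPf ji; rewrite wE AE inE ji.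
have -> : (a < starP p q t) = (a * (du * dv) < N).
  by rewrite -starP_du_dv ltr_pM2r// mulr_gt0.
have ReE mu : (a / N * mu - 1 < 0) = (a * mu < N).
  by rewrite subr_lt0 mulrAC ltr_pdivrMr// mul1r.
split=> [st|adudv z zeig].
  rewrite -ReE; suff zeig : complex_eigenvalue (warm_star_D a w)
      (real_complex R (a / N * (du * dv) - 1)) by exact: st zeig.
  (* The eigenvector for du dv, constant on the two blocks; its pairing with r is (1 - du) (1 -
     dv). *)
  pose x : 'rV[R]_n := \row_j (if j == i0 then 1 - dv else 1 - du).
  have xc : \sum_i x 0 i * (N * w 0 i - 1) = (1 - du) * (1 - dv).
    have := (equilibriumE a w n0).1 weq => -[_ w1 _].
    have p1 : \sum_i (N * w 0 i - 1) = 1.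
      by rewrite sumrB -mulr_sumr w1 sumr_const card_ord mulr1 /N -natr1; ring.
    have ps : \sum_(i | i != i0) (N * w 0 i - 1) = 1 - (N * (t * u) - 1).
      by rewrite -[X in _ = X - _]p1 [X in _ = X - _](bigD1 i0)//= wi0; ring.
    rewrite (bigD1 i0)//= mxE eqxx wi0.
    rewrite (eq_bigr (fun i => (1 - du) * (N * w 0 i - 1))); last first.
      by move=> i /negPf ii0; rewrite mxE ii0.
    rewrite -mulr_sumr ps.
    have -> : (1 - du) * (1 - dv) = 1 - du - dv + du * dv by ring.
    by rewrite -(block_eigenvalue A1); ring.
  apply: (@complex_eigenvalue_real _ _ _ _ x) => //.
    have [j jA jw] := two_valued_out.
    have ji : j != i0 by move: jA; rewrite AE inE.
    apply/negP => /eqP x0; have := congr1 (fun y : 'rV[R]_n => y 0 i0) x0.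
    have := congr1 (fun y : 'rV[R]_n => y 0 j) x0; rewrite !mxE eqxx (negPf ji).
    (* A zero vector would force du = dv = 1, against a du < N < a dv. *)
    move=> /subr0_eq du1 /subr0_eq dv1.
    by have := two_valued_Rolle; rewrite -du1 -dv1 => /andP[/lt_trans/[apply]]; rewrite ltxx.
  move=> j; rewrite xc mxE; case: eqP => [->|/eqP ji].
    by rewrite wi0 dvE; ring.
  by rewrite wj// duE; ring.
have [mu muE ->] := complex_eigenvalue_equilibrium a0 weq wj zeig.
rewrite /= ReE; case: muE => ->.
- by rewrite mulr0.
- by rewrite duE; case/andP: two_valued_Rolle.
- by rewrite wi0 duE dvE (block_eigenvalue A1).
Qed.

End two_valued.

(** * Classification *)

Definition block_hi (R : realType) (n k : nat) (t : R) : R := t / (k%:R * t + (n - k)%:R).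
Definition block_lo (R : realType) (n k : nat) (t : R) : R := (k%:R * t + (n - k)%:R)^-1.

Lemma block_lo_lt_hi (R : realType) (n k : nat) (t : R) : (k < n)%N -> 1 < t ->
  block_lo n k t < block_hi n k t.
Proof.
move=> kn t1; rewrite /block_lo /block_hi ltr_pMl// invr_gt0 ltr_wpDl ?ltr0n ?subn_gt0//.
by rewrite mulr_ge0// ltW// (lt_trans ltr01).
Qed.

(** Cross multiplication reduces this to 0 < (n - k) (t - s). Monotonicity of v in a is thus
    inherited from the ratio t. *)
Lemma block_hi_incr (R : realType) (n k : nat) (s t : R) : (k < n)%N -> 0 < s -> s < t ->
  block_hi n k s < block_hi n k t.
Proof.
move=> kn s0 st; have t0 : 0 < t by exact: lt_trans st.
have q0 : 0 < (n - k)%:R :> R by rewrite ltr0n subn_gt0.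
have D x : 0 < x -> 0 < k%:R * x + (n - k)%:R :> R.
  by move=> x0; rewrite ltr_wpDl// mulr_ge0// ltW.
rewrite /block_hi ltr_pdivrMr ?D// mulrAC ltr_pdivlMr ?D//.
move: q0; set p := k%:R; set q := (n - k)%:R => q0.
suff : 0 < q * (t - s) by lra.
by rewrite mulr_gt0// subr_gt0.
Qed.

Lemma two_block_set (R : realType) (n k : nat) (t : R) (w : 'rV[R]_n) : (k <= n)%N ->
  equal_up_to_perm w (two_block n k (block_hi n k t) (block_lo n k t)) ->
  exists2 A : {set 'I_n}, #|A| = k & forall i, w 0 i =
    if i \in A then t * (#|A|%:R * t + (n - #|A|)%:R)^-1
    else (#|A|%:R * t + (n - #|A|)%:R)^-1.
Proof. by move=> kn /two_block_perm-/(_ kn)[A Ak wA]; exists A; rewrite // Ak. Qed.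

Lemma two_block_equilibrium (R : realType) (n k : nat) (a t : R) (w : 'rV[R]_n) :
  (0 < k)%N -> (k < n)%N -> 1 < t -> k%:R * t < k%:R + 1 ->
  starA k%:R (n - k)%:R t = a ->
  equal_up_to_perm w (two_block n k (block_hi n k t) (block_lo n k t)) -> equilibrium a w.
Proof.
move=> k0 kn t1 tp At /(two_block_set (ltnW kn))[A Ak wA].
by apply/(two_valued_equilibrium (A := A) (t := t)) => //; rewrite Ak.
Qed.

Lemma two_block_stable (R : realType) (n k : nat) (a t : R) (w : 'rV[R]_n) :
  (0 < k)%N -> (k < n)%N -> 1 < t -> k%:R * t < k%:R + 1 ->
  starA k%:R (n - k)%:R t = a -> 1 < a ->
  equal_up_to_perm w (two_block n k (block_hi n k t) (block_lo n k t)) ->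
  linearly_stable a w <-> k = 1%N /\ a < starP k%:R (n - k)%:R t.
Proof.
move=> k0 kn t1 tp At a1 wE; have weq := two_block_equilibrium k0 kn t1 tp At wE.
have [A Ak wA] := two_block_set (ltnW kn) wE.
have A0 : (0 < #|A|)%N by rewrite Ak.
have An : (#|A| < n)%N by rewrite Ak.
have [k1|k1] := eqVneq k 1%N.
  rewrite -Ak (two_valued_singleton_stable A0 An t1 wA a1 weq); last by rewrite Ak.
  by split=> [?|[]]//; split; rewrite // Ak.
split=> [st|[/eqP]]; last by rewrite (negPf k1).
exfalso; apply: (two_valued_not_stable A0 An t1 wA a1 weq) st.
by rewrite Ak ltn_neqAle eq_sym k1.
Qed.

Lemma equilibrium_const_or_two_block (R : realType) (n : nat) (a : R) (w : 'rV[R]_n) :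
  (0 < n)%N -> 1 < a -> equilibrium a w ->
  w = const_mx n%:R^-1 \/
  exists k t, [/\ (0 < k)%N, (k < n)%N, 1 < t, k%:R * t < k%:R + 1 &
    starA k%:R (n - k)%:R t = a /\
    equal_up_to_perm w (two_block n k (block_hi n k t) (block_lo n k t))].
Proof.
move=> n0 a1 weq; have [w0 w1 _] := (equilibriumE a w n0).1 weq.
have [/existsP[i /existsP[j wij]]|/existsPn w_const] :=
    boolP [exists i, exists j, w 0 i < w 0 j]; last first.
  left; pose i0 := Ordinal n0.
  have wc i : w 0 i = w 0 i0.
    apply/eqP; rewrite eq_le !leNgt.
    by have /existsPn/(_ i)-> := w_const i0; have /existsPn/(_ i0)-> := w_const i.
  have n0' : n%:R != 0 :> R by rewrite pnatr_eq0 -lt0n.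
  apply/rowP => i; rewrite mxE wc; apply: (mulfI n0'); rewrite divff// -[RHS]w1.
  by rewrite (eq_bigr (fun=> w 0 i0))// sumr_const card_ord mulr_natl.
(* The block of the larger value w_j; all other coordinates equal w_i. The ratio t of the two values
   and the normalisation then determine both. *)
right; pose A : {set 'I_n} := [set l | w 0 l == w 0 j]%SET.
have wA l : w 0 l = if l \in A then w 0 j else w 0 i.
  rewrite inE; case: eqP => // /eqP wlj.
  by have [//|/eqP] := equilibrium_two_values l a1 weq wij; rewrite (negPf wlj).
have A0 : (0 < #|A|)%N by apply/card_gt0P; exists j; rewrite inE.
have An : (#|A| < n)%N.
  rewrite -[X in (_ < X)%N]card_ord -(cardC (mem A)) -[X in (X < _)%N]addn0 ltn_add2l.
  by apply/card_gt0P; exists i; rewrite !inE lt_eqF.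
pose t := w 0 j / w 0 i.
have t1 : 1 < t by rewrite ltr_pdivlMr// mul1r.
have D : w 0 i * (#|A|%:R * t + (n - #|A|)%:R) = 1.
  have := w1; under eq_bigr do rewrite wA.
  by rewrite sum_two_values => e; rewrite -[RHS]e /t; field; rewrite gt_eqF.
have D0 : #|A|%:R * t + (n - #|A|)%:R != 0.
  by apply: contra_eq_neq D => ->; rewrite mulr0 eq_sym oner_eq0.
have iE : (#|A|%:R * t + (n - #|A|)%:R)^-1 = w 0 i.
  by apply: (mulIf D0); rewrite mulVf.
have jE : t * w 0 i = w 0 j by rewrite divfK// gt_eqF.
have wA' l : w 0 l = if l \in A then t * (#|A|%:R * t + (n - #|A|)%:R)^-1
    else (#|A|%:R * t + (n - #|A|)%:R)^-1 by rewrite iE jE.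
have [tp At] := (two_valued_equilibrium A0 An t1 wA' a).1 weq.
exists #|A|, t; split=> //; split=> //.
by apply/(two_block_perm _ _ _ (ltnW An)); exists A.
Qed.

(** Choice over pairs (k, n) makes the threshold a function of both, available before n is fixed. *)
Lemma fold_branches_choice (R : realType) :
  exists (al : nat -> nat -> R) (tr tl : nat -> nat -> R -> R),
  forall n k : nat, (0 < k)%N -> (2 * k < n)%N ->
    fold_branches k%:R (n - k)%:R (al k n) (tr k n) (tl k n).
Proof.
have /choice[f fP] : forall kn : nat * nat, exists y : R * (R -> R) * (R -> R),
    (0 < kn.1)%N -> (2 * kn.1 < kn.2)%N ->
    fold_branches kn.1%:R (kn.2 - kn.1)%:R y.1.1 y.1.2 y.2.
  move=> [k n]/=; have [/andP[k0 kn]|kn] := boolP ((0 < k) && (2 * k < n))%N.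
    have [|||al [tr [tl h]]] := @fold_branches_exist R k%:R (n - k)%:R.
    - by rewrite ltr0n.
    - by rewrite ltr0n subn_gt0; lia.
    - by rewrite ltr_nat; lia.
    by exists (al, tr, tl).
  by exists (0, id, id) => k0 k2; move: kn; rewrite k0 k2.
exists (fun k n => (f (k, n)).1.1), (fun k n => (f (k, n)).1.2), (fun k n => (f (k, n)).2).
by move=> n k; exact: (fP (k, n)).
Qed.

Lemma monotone_branch_choice (R : realType) :
  exists tr : nat -> nat -> R -> R,
  forall n k : nat, (0 < k)%N -> (k < n)%N -> (n <= 2 * k)%N ->
    monotone_branch k%:R (n - k)%:R (tr k n).
Proof.
have /choice[f fP] : forall kn : nat * nat, exists y : R -> R,
    (0 < kn.1)%N -> (kn.1 < kn.2)%N -> (kn.2 <= 2 * kn.1)%N ->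
    monotone_branch kn.1%:R (kn.2 - kn.1)%:R y.
  move=> [k n]/=; have [/and3P[k0 kn nk]|kn] := boolP [&& 0 < k, k < n & n <= 2 * k]%N.
    have [|||tr h] := @monotone_branch_exists R k%:R (n - k)%:R.
    - by rewrite ltr0n.
    - by rewrite ltr0n subn_gt0.
    - by rewrite ler_nat; lia.
    by exists tr.
  by exists id => k0 k1 k2; move: kn; rewrite k0 k1 k2.
exists (fun k n => f (k, n)).
by move=> n k; exact: (fP (k, n)).
Qed.

(** For k = 1 the ratio t is bounded by 2. With q = n - 1 the difference equals (2 - t) q / ((q + 2)
    (t + q)), and the factor of 2 - t lies in [0, 1]. *)
Lemma block_hi_limit (R : realType) (n : nat) (t : R) : (1 < n)%N -> 1 < t -> t < 2 ->
  `|2 / n.+1%:R - block_hi n 1 t| <= 2 - t.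
Proof.
move=> n1 t1 t2; have q0 : 1 <= (n - 1)%:R :> R by rewrite ler1n subn_gt0.
have NE : n.+1%:R = (n - 1)%:R + 2 :> R by rewrite -natrD; congr _%:R; lia.
rewrite NE /block_hi mul1r; move: q0; set q := (n - 1)%:R => q0.
have -> : 2 / (q + 2) - t / (t + q) = (2 - t) * (q / ((q + 2) * (t + q))).
  by field; apply/andP; split; rewrite gt_eqF//; lra.
have D0 : 0 < (q + 2) * (t + q) by apply: mulr_gt0; lra.
have f0 : 0 <= q / ((q + 2) * (t + q)) by rewrite divr_ge0 ?ltW//; lra.
have f1 : q / ((q + 2) * (t + q)) <= 1 by rewrite ler_pdivrMr// mul1r; nra.
have t0 : 0 <= 2 - t by lra.
by rewrite ger0_norm; [exact: ler_piMr|exact: mulr_ge0].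
Qed.

Unset Implicit Arguments.

Theorem theorem3p3 (R : realType) :
  exists at_ : nat -> nat -> R,
  forall n : nat, (2 <= n)%N ->
  (forall k : nat, (1 <= k <= n)%N -> 1 < at_ k n < n.+1%:R) /\
  exists v2 u2 v3 u3 v4 u4 : nat -> R -> R,
    let ii (k : nat) (a : R) :=
      [/\ (1 <= k)%N, (2 * k < n)%N & at_ k n <= a] in
    let iii (k : nat) (a : R) :=
      [/\ (1 <= k)%N, (2 * k < n)%N & at_ k n < a < n.+1%:R] in
    let iv (k : nat) (a : R) :=
      [/\ (n <= 2 * k)%N, (k <= n.-1)%N & n.+1%:R < a] in
    (* v > u, and monotonicity of v in each of the three families *)
    [/\ forall k a, ii k a -> u2 k a < v2 k a,
        forall k a, iii k a -> u3 k a < v3 k a,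
        forall k a, iv k a -> u4 k a < v4 k a &
        [/\ forall k a b, ii k a -> ii k b -> a < b -> v2 k a < v2 k b,
            forall k a b, iii k a -> iii k b -> a < b -> v3 k b < v3 k a &
            forall k a b, iv k a -> iv k b -> a < b -> v4 k a < v4 k b]] /\
    (* the equilibria, up to permutation of coordinates *)
    (forall (a : R) (w : 'rV[R]_n), 1 < a ->
      (equilibrium a w <->
       [\/ w = const_mx n%:R^-1,
           exists2 k, ii k a &
             equal_up_to_perm w (two_block n k (v2 k a) (u2 k a)),
           exists2 k, iii k a &
             equal_up_to_perm w (two_block n k (v3 k a) (u3 k a)) |
           exists2 k, iv k a &
             equal_up_to_perm w (two_block n k (v4 k a) (u4 k a))])) /\
    (* stability of (i) *)
    (forall a : R, 1 < a ->
      (linearly_stable a (const_mx n%:R^-1 : 'rV[R]_n) <-> a < n.+1%:R)) /\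
    critical n.+1%:R (const_mx n%:R^-1 : 'rV[R]_n) /\
    (* stability of (ii), and the limit of v along its stable branch *)
    (forall (k : nat) (a : R) (w : 'rV[R]_n), ii k a ->
      equal_up_to_perm w (two_block n k (v2 k a) (u2 k a)) ->
      (linearly_stable a w <-> k = 1%N /\ at_ 1%N n < a)) /\
    ((2 < n)%N -> v2 1%N a @[a --> +oo] --> (2%:R / n.+1%:R : R)) /\
    (* all other equilibria are not linearly stable, apart from (iv) for
       n = 2, which is *)
    (forall (k : nat) (a : R) (w : 'rV[R]_n), iii k a ->
      equal_up_to_perm w (two_block n k (v3 k a) (u3 k a)) ->
      ~ linearly_stable a w) /\
    (forall (k : nat) (a : R) (w : 'rV[R]_n), iv k a ->
      equal_up_to_perm w (two_block n k (v4 k a) (u4 k a)) ->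
      (linearly_stable a w <-> n = 2%N)).
Proof.
have [al [tr [tl fold]]] := fold_branches_choice R.
have [tm mono] := monotone_branch_choice R.
(* The bounds on the threshold are asked for every k up to n; for k >= n / 2 the value 1 + n / 2
   lies strictly between 1 and n + 1. *)
exists (fun k n => if (0 < k)%N && (2 * k < n)%N then al k n else 1 + n%:R / 2).
move=> n n2; have n0 : (0 < n)%N by exact: ltnW.
have NE k : (k < n)%N -> n.+1%:R = k%:R + (n - k)%:R + 1 :> R.
  by move=> kn; rewrite -natrD subnKC ?natr1// ltnW.
split.
  move=> k _; case: ifP => [/andP[k0 kn]|_].
    by have := fold_al (fold n k k0 kn); rewrite -NE//; lia.
  have : 0 < n%:R :> R by rewrite ltr0n.
  by rewrite -[n.+1%:R]natr1; set x := n%:R => x0; apply/andP; split; lra.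
(* Families (ii) and (iii) are the increasing and the decreasing branch of the folded profile; (iv)
   is the branch of the monotone one. *)
exists (fun k a => block_hi n k (tr k n a)), (fun k a => block_lo n k (tr k n a)).
exists (fun k a => block_hi n k (tl k n a)), (fun k a => block_lo n k (tl k n a)).
exists (fun k a => block_hi n k (tm k n a)), (fun k a => block_lo n k (tm k n a)).
move=> ii iii iv.
have iiP k a : ii k a -> [/\ (0 < k)%N, (k < n)%N,
    fold_branches k%:R (n - k)%:R (al k n) (tr k n) (tl k n) & al k n <= a].
  by move=> [k0 kn]; rewrite k0 kn => ala; split=> //; [lia|exact: fold].
have iiiP k a : iii k a -> [/\ (0 < k)%N, (k < n)%N,
    fold_branches k%:R (n - k)%:R (al k n) (tr k n) (tl k n) &
    al k n < a < k%:R + (n - k)%:R + 1].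
  move=> [k0 kn]; rewrite k0 kn => ala; have kn' : (k < n)%N by lia.
  by rewrite -NE//; split=> //; exact: fold.
have ivP k a : iv k a -> [/\ (0 < k)%N, (k < n)%N,
    monotone_branch k%:R (n - k)%:R (tm k n) & k%:R + (n - k)%:R + 1 < a].
  move=> [nk kn Na]; have k0 : (0 < k)%N by lia.
  have kn' : (k < n)%N by lia.
  by rewrite -NE//; split=> //; exact: mono.
split.
  split; [| | |split].
  - move=> k a /iiP[k0 kn fb ala]; apply: block_lo_lt_hi => //.
    by have [] := fold_tr fb ala.
  - move=> k a /iiiP[k0 kn fb ala]; apply: block_lo_lt_hi => //.
    by have [] := fold_tl fb ala.
  - move=> k a /ivP[k0 kn mb Na]; apply: block_lo_lt_hi => //.
    by have [] := monotone_tr mb Na.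
  - move=> k a b /iiP[k0 kn fb ala] _ ab; apply: block_hi_incr => //.
      by have [/(lt_trans ltr01)] := fold_tr fb ala.
    exact: (fold_tr_incr fb).
  - move=> k a b /iiiP[k0 kn fb /andP[ala aN]] /iiiP[_ _ _ bN] ab; apply: block_hi_incr => //.
      by have [/(lt_trans ltr01)] := fold_tl fb bN.
    by apply: (fold_tl_decr fb) => //; case/andP: bN.
  - move=> k a b /ivP[k0 kn mb Na] _ ab; apply: block_hi_incr => //.
      by have [/(lt_trans ltr01)] := monotone_tr mb Na.
    exact: (monotone_tr_incr mb).
split.
  move=> a w a1; split; last first.
    case=> [->|[k /iiP[k0 kn fb ala]]|[k /iiiP[k0 kn fb ala]]|[k /ivP[k0 kn mb Na]]].
    - exact: const_equilibrium.
    - by have [t1 tp At _] := fold_tr fb ala; exact: two_block_equilibrium.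
    - by have [t1 tp At _] := fold_tl fb ala; exact: two_block_equilibrium.
    - by have [t1 tp At _] := monotone_tr mb Na; exact: two_block_equilibrium.
  move=> /(equilibrium_const_or_two_block n0 a1)[->|]; first by constructor 1.
  move=> [k [t [k0 kn t1 tp [At wE]]]].
  (* The position of k relative to n / 2 selects the folded or the monotone profile; in the folded
     case the side of the minimum selects (ii) or (iii). *)
  have [k2|k2] := ltnP (2 * k) n.
    have fb := fold n k k0 k2.
    have := fold_complete fb t1 tp; rewrite At => -[[ala tE]|[ala tE]].
      by constructor 2; exists k; rewrite -?tE//; split; rewrite // k0 k2.
    constructor 3; exists k; rewrite -?tE//; split; rewrite // k0 k2//=.
    by rewrite (NE k).
  have := monotone_complete (mono n k k0 kn k2) t1 tp; rewrite At => -[Na tE].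
  by constructor 4; exists k; rewrite -?tE//; split; rewrite ?(NE k)//; lia.
split; first by move=> a a1; apply: const_stable => //; exact: lt_trans a1.
split; first exact: const_critical.
split.
  move=> k a w /[dup]/iiP[k0 kn fb ala] [_ k2 _] wE.
  have [t1 tp At aP] := fold_tr fb ala.
  have a1 : 1 < a by apply: lt_le_trans ala; case/andP: (fold_al fb).
  (* On this branch a < starP amounts to a lying strictly above the threshold, so stability fails at
     the fold itself. *)
  rewrite (two_block_stable k0 kn t1 tp At a1 wE) aP.
  by split=> -[k1]; move: k2; rewrite k1 !muln1 => ->.
split.
  move=> n3; have fb := fold n 1%N isT n3.
  apply/cvgrPdist_lt => e e0.
  (* This t is within e / 2 of 2 and, thanks to 3 / 2, above 1. For large a the ratio lies in (t,
     2), so [block_hi_limit] bounds the distance by e / 2. *)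
  pose t := Num.max (3 / 2) (2 - e / 2).
  have t1 : 1 < t by rewrite lt_max; apply/orP; left; lra.
  have t2 : t < 2 by rewrite gt_max; apply/andP; split; lra.
  have te : 2 - t <= e / 2.
    have : 2 - e / 2 <= t by rewrite le_max lexx orbT.
    by lra.
  have [|M tM] := fold_tr_large fb (t := t); first by rewrite mul1r.
  near=> a; have aM : M < a by near: a; apply: nbhs_pinfty_gt; rewrite num_real.
  have ala : al 1%N n <= a by near: a; apply: nbhs_pinfty_ge; rewrite num_real.
  have [s1 sp _ _] := fold_tr fb ala.
  have s2 : tr 1%N n a < 2 by move: sp; rewrite mul1r.
  apply: (le_lt_trans (block_hi_limit n2 s1 s2)).
  by have := tM a aM; lra.
split.
  move=> k a w /iiiP[k0 kn fb ala] wE; have [t1 tp At Pa] := fold_tl fb ala.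
  have a1 : 1 < a.
    by case/andP: ala => ala _; apply: lt_trans ala; case/andP: (fold_al fb).
  (* On the decreasing branch starP < a, so even k = 1 is not stable. *)
  by rewrite (two_block_stable k0 kn t1 tp At a1 wE) => -[_ /(lt_trans Pa)]; rewrite ltxx.
move=> k a w /[dup]/ivP[k0 kn mb Na] [nk _ _] wE; have [t1 tp At aP] := monotone_tr mb Na.
have a1 : 1 < a.
  by apply: lt_trans Na; rewrite ltrDr addr_gt0// ltr0n ?subn_gt0.
(* Here a < starP along the whole branch, so stability means k = 1, which together with n <= 2 k and
   k < n is equivalent to n = 2. *)
rewrite (two_block_stable k0 kn t1 tp At a1 wE).
by split=> [[k1 _]|n2']; [lia|split=> //; lia].
Unshelve. all: by end_near.
Qed.
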